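(* Let $d=p^e$, where $p$ is a prime and $e\geq 1$. Let $m\geq 2$, $n\geq 1$, let $\zeta\neq 1$ be a $d$-th root of unity, let $c_0$ be a root of $G_{d,m,n}^{\zeta}$, and let $K:=\mathbb{Q}(c_0)$. Let $\ell\geq 1$ and $j\geq 2$. Then, as ideals of $\mathcal{O}_K$: (a) If $\ell\neq n$ and $j\neq m$, then $\langle G_{d,j,\ell}^{\zeta}(c_0)\rangle=\mathcal{O}_K$. (b) If $\ell=n$ and $j<m$, then $\langle G_{d,j,\ell}^{\zeta}(c_0)\rangle=\langle a_n(c_0)\rangle^{N_{j,n}}$, where $N_{j,n}=d^{j-1}$ if $n\nmid j-1$ and $N_{j,n}=d^{j-1}-1$ if $n\mid j-1$. (c) If $\ell=n$ and $j>m$, then $\langle G_{d,j,\ell}^{\zeta}(c_0)\rangle=\langle 1-\zeta\rangle$.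
   Context: Let $f_{d,c}(z)=z^d+c$ and $a_i(c):=f_{d,c}^i(0)\in\mathbb{Z}[c]$. For integers $m\geq 2$, $n\geq 1$ and a $d$-th root of unity $\zeta\neq 1$, the Misiurewicz polynomial is $G_{d,m,n}^{\zeta}(c):=\prod_{k\mid n}(a_{m+k-1}-\zeta a_{m-1})^{\mu(n/k)}\cdot \prod_{k\mid n}(a_k)^{-\mu(n/k)}$ if $n\mid m-1$, and $G_{d,m,n}^{\zeta}(c):=\prod_{k\mid n}(a_{m+k-1}-\zeta a_{m-1})^{\mu(n/k)}$ if $n\nmid m-1$ ($\mu$ the Möbius function); it is a monic polynomial in $\mathbb{Z}[\zeta][c]$, and $\zeta\in\mathbb{Q}(c_0)$ for any root $c_0$. $\langle b\rangle$ denotes the principal ideal generated by $b$. *)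

(* Defs.v *)
From mathcomp Require Import all_boot all_order all_algebra all_field.
From mathcomp Require Import boolp classical_sets.

Set Implicit Arguments.
Unset Strict Implicit.
Unset Printing Implicit Defensive.

Import GRing.Theory.
Local Open Scope ring_scope.
Local Open Scope quotient_scope.
Local Open Scope classical_set_scope.

Notation "x %:F" := (@FracField.tofrac _ x) : ring_scope.

Definition moebius (n : nat) : int :=
  if all (fun p => logn p n == 1%N) (primes n)
  then (-1) ^+ size (primes n) else 0.

Definition unicritical (R : nzRingType) (d : nat) (c z : R) : R := z ^+ d + c.

Definition crit_orbit (d i : nat) : {poly algC} :=
  iter i (unicritical d 'X) 0.

Definition misiurewicz_frac (d m n : nat) (zeta : algC) :
    {fraction {poly algC}} :=
  let P := \prod_(k <- divisors n)
    (crit_orbit d (m + k - 1) - zeta *: crit_orbit d (m - 1))%:F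
      ^ moebius (n %/ k) in
  if (n %| m - 1)%N
  then P * \prod_(k <- divisors n) (crit_orbit d k)%:F ^ (- moebius (n %/ k))
  else P.

(* The polynomial equal to a given rational function, when there is one
   (poly_of_fracK); otherwise a junk value. *)
Definition poly_of_frac (F : fieldType) (x : {fraction {poly F}}) : {poly F} :=
  \n_(repr x) %/ \d_(repr x).

Lemma poly_of_fracK (F : fieldType) (q : {poly F}) : poly_of_frac q%:F = q.
Proof.
rewrite /poly_of_frac; set r := repr _.
have : \pi_({fraction {poly F}}) r = \pi_({fraction {poly F}}) (Ratio q 1).
  by rewrite reprK; unlock FracField.tofrac.
move/eqP; rewrite FracField.equivf_def /FracField.equivf.
rewrite !numden_Ratio ?oner_neq0 // mulr1 => /eqP ->.
by rewrite mulKp ?denom_ratioP.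
Qed.

Definition misiurewicz (d m n : nat) (zeta : algC) : {poly algC} :=
  poly_of_frac (misiurewicz_frac d m n zeta).

Definition Qadjoin (c : algC) : set algC :=
  [set x | exists u v : {poly rat},
     (map_poly ratr v).[c] != 0 /\
     x = (map_poly ratr u).[c] / (map_poly ratr v).[c]].

Definition ring_of_integers (K : set algC) : set algC :=
  [set x | K x /\ x \in Aint].

Definition principal_ideal (O : set algC) (b : algC) : set algC :=
  [set b * x | x in O].

Definition ideal_mul (I J : set algC) : set algC :=
  [set x | exists s : seq (algC * algC),
     (forall y, y \in s -> I y.1 /\ J y.2) /\
     x = \sum_(y <- s) y.1 * y.2].

Definition ideal_exp (O I : set algC) (N : nat) : set algC :=
  iter N (ideal_mul I) O.

(* N_{j,n} *)
Definition misiurewicz_exponent (d j n : nat) : nat :=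
  if (n %| j - 1)%N then (d ^ (j - 1) - 1)%N else (d ^ (j - 1))%N.

(* Main.v *)
Require Import Defs.
From HB Require Import structures.
From mathcomp Require Import all_boot all_order all_algebra all_field.
From mathcomp Require Import boolp classical_sets.
From mathcomp Require Import ring zify.

Set Implicit Arguments.
Unset Strict Implicit.
Unset Printing Implicit Defensive.

Import GRing.Theory Num.Theory.
Local Open Scope ring_scope.

(** Write [a_i] for [a_i(c0)] and [M = m - 1], [J = j - 1]. An algebraic number is an
    algebraic integer iff it lies in every valuation ring [V] of [algC], so the equalities
    of principal ideals can be checked in each [V] separately.

    All the polynomials [a_k] and [a_(M+k) - zeta a_M] have simple roots, because in a
    valuation ring above [p] their derivatives are a unit and [1 - zeta] times a unit. For
    fixed [c], the set of [k > 0] at which one of them vanishes at [c] is empty or of the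
    form [q N]; Moebius inversion then shows that [G_(m,n)] is the product of the [X - c]
    over the [c] whose critical orbit has preperiod [m] and exact period [n], with
    [a_(M+n) = zeta a_M]. In particular, for [j <> m], [G_(j,l)(c0)] is the product of the
    values at [c0] of its factors, none of which vanishes.

    Away from [p], every [a_k] and every [a_(J+k) - zeta a_J] with [J <> M] is a unit.
    Above [p], raising to the power [d] is additive modulo [p]; hence [a_k] and
    [a_(J+k) - zeta a_J] are units unless [n] divides [k]. If [n] divides [k], then [a_k]
    is associated to [a_n], and [a_(J+k) - zeta a_J] is associated to [a_n ^ (d ^ J)] if
    [J < M] and equal to [(1 - zeta) a_J] if [J > M]. A second Moebius inversion gives the
    theorem. *)

(** * Valuation rings *)

Record valuation_ring (F : fieldType) := ValuationRing {
  valuation_mem :> {pred F};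
  valuation_subring : subring_closed valuation_mem;
  valuation_total : forall x, (x \in valuation_mem) || (x^-1 \in valuation_mem) }.

HB.instance Definition _ (F : fieldType) (V : valuation_ring F) :=
  GRing.isSubringClosed.Build F (valuation_mem V) (valuation_subring V).

(** Valuation rings are integrally closed: if [x] is not in [V] then [x^-1] is, and dividing the
    monic equation by a power of [x] writes [x] as a polynomial in [x^-1] over [V]. *)
Lemma monic_root_valuation (F : fieldType) (V : valuation_ring F)
    (q : {poly F}) (x : F) :
  q \is monic -> q \is a polyOver V -> root q x -> x \in V.
Proof.
move=> mq Vq rx; case/orP: (valuation_total V x) => // Vxi.
have [->|x0] := eqVneq x 0; first exact: rpred0.
have s1 : (1 < size q)%N.
  by rewrite ltnNge; apply/negP => /(size1_polyC) qC; move: mq rx;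
     rewrite qC monicE lead_coefC => /eqP ->; rewrite rootC oner_eq0.
have [n sq] : exists n, size q = n.+2 by exists (size q).-2; case: (size q) s1 => [|[]].
have := rx; rewrite rootE horner_coef sq big_ord_recr /=.
have -> : q`_n.+1 = 1 by move: mq; rewrite monicE lead_coefE sq => /eqP.
rewrite mul1r addrC addr_eq0 => /eqP E.
have -> : x = - \sum_(i < n.+1) q`_i * x^-1 ^+ (n - i).
  apply: (mulIf (expf_neq0 n x0)); rewrite -exprS E mulNr; congr (- _).
  rewrite mulr_suml; apply: eq_bigr => i _; rewrite -mulrA; congr (_ * _).
  have le_in : (i <= n)%N by rewrite -ltnS.
  have -> : x ^+ n = x ^+ (n - i) * x ^+ i by rewrite -exprD subnK.
  by rewrite mulrA -exprMn mulVf // expr1n mul1r.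
by rewrite rpredN; apply: rpred_sum => i _; rewrite rpredM ?rpredX // (polyOverP Vq).
Qed.

(** * Subrings maximal among those omitting [y^-1] *)

Section MaximalSubring.

Variables (F : fieldType) (y : F) (A : subringClosed F).
Hypotheses (Ay : y \in A) (Ayi : y^-1 \notin A).
Hypothesis A_max : forall B : {pred F}, subring_closed B ->
  {subset A <= B} -> y^-1 \notin B -> {subset B <= A}.

Let y0 : y != 0.
Proof. by apply: contraNneq Ayi => ->; rewrite invr0 rpred0. Qed.

Let adjoin (z : F) : {pred F} :=
  fun x => `[< exists2 P : {poly F}, P \is a polyOver A & x = P.[z] >].

Let adjoin_ring z : subring_closed (adjoin z).
Proof.
split.
- by apply/asboolP; exists 1; rewrite ?rpred1 ?hornerC.
- move=> _ _ /asboolP[P AP ->] /asboolP[Q AQ ->]; apply/asboolP.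
  by exists (P - Q); rewrite ?rpredB // !hornerE.
- move=> _ _ /asboolP[P AP ->] /asboolP[Q AQ ->]; apply/asboolP.
  by exists (P * Q); rewrite ?rpredM // hornerM.
Qed.

(** The ring [A[z]] is strictly larger than [A], so by maximality it contains [y^-1]. *)
Let adjoin_spec z : z \notin A ->
  exists2 P : {poly F}, P \is a polyOver A & y * P.[z] = 1.
Proof.
move=> Az; have [|nyi] := boolP (y^-1 \in adjoin z).
  by case/asboolP=> P AP E; exists P; rewrite // -E divff.
case/negP: Az; apply: (A_max (adjoin_ring z)) nyi _ _.
  by move=> x Ax; apply/asboolP; exists x%:P; rewrite ?polyOverC ?hornerC.
by apply/asboolP; exists 'X; rewrite ?polyOverX ?hornerX.
Qed.

(* If u = 1 - y a were not invertible in A, then y^-1 = b / u^N for some b in A,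
   so that u^N = y b and 1 would be a multiple of y. *)
Let one_sub_unit a : a \in A -> (1 - y * a)^-1 \in A.
Proof.
move=> Aa; set u := 1 - y * a; apply: contraT => /adjoin_spec[P AP E].
have Au : u \in A by rewrite rpredB ?rpred1 ?rpredM.
have u0 : u != 0.
  apply: contraNneq Ayi => /eqP; rewrite subr_eq0 => /eqP E1.
  by have -> : y^-1 = a by rewrite -[LHS]mulr1 E1 mulKf.
pose N := size P; pose b := \sum_(i < N) P`_i * u ^+ (N - i).
have Ab : b \in A by apply: rpred_sum => i _; rewrite rpredM ?rpredX // (polyOverP AP).
have Eb : y * b = u ^+ N.
  have -> : b = P.[u^-1] * u ^+ N; last by rewrite mulrA E mul1r.
  rewrite horner_coef mulr_suml; apply: eq_bigr => i _; rewrite -mulrA; congr (_ * _).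
  have le_iN : (i <= N)%N by rewrite ltnW.
  have -> : u ^+ N = u ^+ i * u ^+ (N - i) by rewrite -exprD subnKC.
  by rewrite mulrA -exprMn mulVf // expr1n mul1r.
pose s := \sum_(i < N) u ^+ i.
have As : s \in A by apply: rpred_sum => i _; rewrite rpredX.
have E1 : 1 = y * (b + a * s).
  have := subrX1 u N; rewrite -/s -Eb {1}/u => E2.
  have -> : 1 = y * b - (y * b - 1) by rewrite opprB addrC subrK.
  by rewrite E2; ring.
have : y^-1 \in A by rewrite -[y^-1]mulr1 E1 mulKf // rpredD ?rpredM.
by rewrite (negPf Ayi).
Qed.

(** Descent step: [1] minus [y] times the constant coefficient of [Q] is invertible in [A], so the
    relation in [z^-1], multiplied by a power of [z], expresses the top power of [z] in [P] through
    lower ones. *)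
Let reduce z (P Q : {poly F}) : z != 0 ->
  P \is a polyOver A -> Q \is a polyOver A -> y * P.[z] = 1 -> y * Q.[z^-1] = 1 ->
  (size Q <= size P)%N ->
  exists P' : {poly F}, [/\ P' \is a polyOver A, y * P'.[z] = 1 &
    (size P' < size P)%N].
Proof.
move=> z0 AP AQ EP EQ leQP.
have sQ : (1 < size Q)%N.
  rewrite ltnNge; apply/negP => /size1_polyC QC; case/negP: Ayi.
  by rewrite -[y^-1]mulr1 -EQ mulKf // QC hornerC (polyOverP AQ).
case sQE : (size Q) sQ leQP => [|[|k]] // _ leQP.
case sPE : (size P) leQP => [|[|r]] // leQP.
have {}leQP : (k <= r)%N by [].
pose w := (1 - y * Q`_0)^-1.
have Aw : w \in A by rewrite one_sub_unit // (polyOverP AQ).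
have w0 : 1 - y * Q`_0 != 0.
  apply: contraNneq Ayi => /eqP; rewrite subr_eq0 => /eqP E1.
  have -> : y^-1 = Q`_0 by rewrite -[LHS]mulr1 E1 mulKf.
  exact: (polyOverP AQ).
have EQ1 : w * (y * \sum_(i < k.+1) Q`_i.+1 * z^-1 ^+ i.+1) = 1.
  move: EQ; rewrite horner_coef sQE big_ord_recl /= expr0 mulr1.
  under eq_bigr => i _ do rewrite -[bump 0 i]/(i.+1).
  by set S := \sum_(i < _) _; rewrite mulrDr -[RHS](subrK (y * Q`_0)) addrC => /addIr ->;
     rewrite mulVf.
(* [T] rewrites [z ^+ r.+1] with exponents at most [r]; the subtraction [r - i] does not truncate
   because [i <= k <= r]. *)
pose T : {poly F} := \sum_(i < k.+1) (w * y * Q`_i.+1) *: 'X^(r - i).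
pose P1 : {poly F} := \poly_(i < r.+1) P`_i.
have AT : T \is a polyOver A.
  by apply: rpred_sum => i _; rewrite polyOverZ ?polyOverXn // !rpredM // (polyOverP AQ).
have ET : T.[z] = z ^+ r.+1.
  rewrite -[RHS]mulr1 -EQ1 horner_sum 2!mulr_sumr mulr_sumr; apply: eq_bigr => i _.
  rewrite hornerZ hornerXn.
  have le_ir : (i <= r)%N by apply: leq_trans leQP; rewrite -ltnS.
  have -> : z ^+ r.+1 = z ^+ (r - i) * z ^+ i.+1 by rewrite -exprD addnS subnK.
  have Ez : z ^+ i.+1 * z^-1 ^+ i.+1 = 1 by rewrite -exprMn divff ?expr1n.
  rewrite -[LHS]mulr1 -Ez; ring.
exists (P1 + P`_r.+1 *: T); split.
- rewrite rpredD ?polyOverZ ?(polyOverP AP) //.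
  by apply/polyOver_poly => i _; rewrite (polyOverP AP).
- rewrite hornerD hornerZ ET -EP; congr (_ * _).
  by rewrite (horner_coef P) sPE big_ord_recr horner_poly.
- rewrite ltnS; apply: leq_trans (size_polyD _ _) _; rewrite geq_max size_poly /=.
  apply: leq_trans (size_scale_leq _ _) _; apply: leq_trans (size_sum _ _ _) _.
  apply/bigmax_leqP => i _; apply: leq_trans (size_scale_leq _ _) _.
  by rewrite size_polyXn ltnS leq_subr.
Qed.

(** If [x] and [x^-1] were both outside [A], then [y^-1] would be a polynomial in each of them, and
    [reduce] could shorten the longer of the two relations forever. *)
Lemma maximal_subring_total x : (x \in A) || (x^-1 \in A).
Proof.
apply: contraT; rewrite negb_or => /andP[Ax Axi].
have x0 : x != 0 by apply: contraNneq Ax => ->; rewrite rpred0.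
have [P AP EP] := adjoin_spec Ax; have [Q AQ EQ] := adjoin_spec Axi.
have [N] := ubnP (size P + size Q)%N.
elim: N P Q AP AQ EP EQ => // N IH P Q AP AQ EP EQ lt_N.
have [leQP|/ltnW lePQ] := leqP (size Q) (size P).
  have [P' [AP' EP' lt_P']] := reduce x0 AP AQ EP EQ leQP.
  by apply: (IH P' Q) => //; lia.
have EP1 : y * P.[x^-1^-1] = 1 by rewrite invrK.
have [Q' [AQ' EQ' lt_Q']] := reduce (invr_neq0 x0) AQ AP EQ EP1 lePQ.
by apply: (IH P Q') => //; lia.
Qed.

End MaximalSubring.

(** Zorn's lemma gives a subring containing [B] that is maximal among those omitting [y^-1]; it is a
    valuation ring by [maximal_subring_total]. *)
Lemma exists_valuation_ring (F : fieldType) (B : {pred F}) (y : F) :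
  subring_closed B -> y \in B -> y^-1 \notin B ->
  exists V : valuation_ring F, y^-1 \notin V.
Proof.
move=> B_ring By Byi.
pose good (X : set F) := [/\ subring_closed (fun x => `[< X x >]),
  (forall x, x \in B -> X x) & ~ X y^-1].
have [|A [[A0|gA] A_max]] := @Zorn_bigcup F (fun X => X = set0 \/ good X).
- move=> C PC totC.
  have [[X CX X0]|none] := pselect (exists2 X, C X & X <> set0); last first.
    left; apply/seteqP; split=> // x [X CX Xx].
    by apply: none; exists X => // X0; rewrite X0 in Xx.
  right; have gX : good X by case: (PC _ CX).
  have up X1 X2 : C X1 -> C X2 -> forall x1 x2, X1 x1 -> X2 x2 ->
      exists Y, [/\ C Y, good Y, Y x1 & Y x2].
    move=> C1 C2 x1 x2 h1 h2.
    have g1 : good X1 by case: (PC _ C1) => // E; rewrite E in h1.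
    have g2 : good X2 by case: (PC _ C2) => // E; rewrite E in h2.
    by case: (totC _ _ C1 C2) => sub; [exists X2 | exists X1]; split=> //; apply: sub.
  split.
  + split.
    * by apply/asboolP; exists X => //; case: gX => [[/asboolP]].
    * move=> x1 x2 /asboolP[X1 C1 h1] /asboolP[X2 C2 h2]; apply/asboolP.
      have [Y [CY [[_ YB _] _ _] /asboolP Y1 /asboolP Y2]] := up _ _ C1 C2 _ _ h1 h2.
      by exists Y => //; apply/asboolP; apply: YB.
    * move=> x1 x2 /asboolP[X1 C1 h1] /asboolP[X2 C2 h2]; apply/asboolP.
      have [Y [CY [[_ _ YM] _ _] /asboolP Y1 /asboolP Y2]] := up _ _ C1 C2 _ _ h1 h2.
      by exists Y => //; apply/asboolP; apply: YM.
  + by move=> x Bx; exists X => //; case: gX => _ + _; apply.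
  + move=> [Y CY Yy]; case: (PC _ CY) => [E|[_ _]]; last exact.
    by rewrite E in Yy.
- case: (A_max (fun x => x \in B)).
    by rewrite A0; split=> // /(_ y By).
  right; split=> //; last exact/negP.
  case: B_ring => [B1 BB BM]; split; first exact/asboolP.
    by move=> x1 x2 /asboolP h1 /asboolP h2; apply/asboolP; apply: BB.
  by move=> x1 x2 /asboolP h1 /asboolP h2; apply/asboolP; apply: BM.
have [A_ring AB Ayi] := gA; pose S : {pred F} := fun x => `[< A x >].
have Sy : y \in S by apply/asboolP; apply: AB.
have Syi : y^-1 \notin S by apply/negP => /asboolP.
have S_max : forall B : {pred F}, subring_closed B ->
    {subset S <= B} -> y^-1 \notin B -> {subset B <= S}.
  move=> D D_ring SD Dyi x Dx; apply/asboolP; apply: contrapT => Ax.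
  case: (A_max (fun x => x \in D)).
    split; last by move=> /(_ x Dx).
    by move=> z Az; apply: SD; apply/asboolP.
  right; split; last exact/negP.
    case: D_ring => [B1 BB BM]; split; first exact/asboolP.
      by move=> x1 x2 /asboolP h1 /asboolP h2; apply/asboolP; apply: BB.
    by move=> x1 x2 /asboolP h1 /asboolP h2; apply/asboolP; apply: BM.
  by move=> z Bz; apply: SD; apply/asboolP; apply: AB.
pose T : subringClosed F := HB.pack S (GRing.isSubringClosed.Build F S A_ring).
by exists (ValuationRing A_ring (@maximal_subring_total F y T Sy Syi S_max)).
Qed.

(** The maximal ideal of [V]. Zero is listed apart since [0^-1 = 0] by convention, which lies in
    [V]. *)
Definition valuation_ideal (F : fieldType) (V : valuation_ring F) : {pred F} :=
  fun x => (x == 0) || (x^-1 \notin V).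

Definition valuation_unit (F : fieldType) (V : valuation_ring F) : {pred F} :=
  fun x => [&& x != 0, x \in V & x^-1 \in V].

(** * The maximal ideal and the units of a valuation ring *)

Section ValuationIdeal.

Variables (F : fieldType) (V : valuation_ring F).
Local Notation mV := (valuation_ideal V).

Lemma valuation_idealE x : (x \in mV) = (x == 0) || (x^-1 \notin V).
Proof. by []. Qed.

Lemma valuation_ideal_sub x : x \in mV -> x \in V.
Proof.
rewrite valuation_idealE => /orP[/eqP ->|nVxi]; first exact: rpred0.
by have := valuation_total V x; rewrite (negPf nVxi) orbF.
Qed.

Lemma valuation_ideal1 : 1 \notin mV.
Proof. by rewrite valuation_idealE oner_eq0 invr1 rpred1. Qed.

Lemma valuation_idealMl x y : x \in V -> y \in mV -> x * y \in mV.
Proof.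
move=> Vx; rewrite !valuation_idealE => /orP[/eqP ->|Vyi]; first by rewrite mulr0 eqxx.
have [->|x0] := eqVneq x 0; first by rewrite mul0r eqxx.
apply/orP; right; apply: contra Vyi => Vxy.
have -> : y^-1 = x * (x * y)^-1 by rewrite invfM mulVKf.
by rewrite rpredM.
Qed.

Lemma valuation_idealMr x y : x \in mV -> y \in V -> x * y \in mV.
Proof. by move=> mx Vy; rewrite mulrC valuation_idealMl. Qed.

(** One of [x / y] and [y / x] lies in [V], so [x - y] is a multiple in [V] of [y] or of [x]. *)
Lemma valuation_ideal_zmod : zmod_closed mV.
Proof.
suff sub x y : x \in mV -> y \in mV -> y != 0 -> x / y \in V -> x - y \in mV.
  split=> [|x y mx my]; first by rewrite valuation_idealE eqxx.
  have [->|y0] := eqVneq y 0; first by rewrite subr0.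
  have [->|x0] := eqVneq x 0.
    by rewrite sub0r -mulN1r valuation_idealMl // rpredN1.
  case/orP: (valuation_total V (x / y)) => [|Vyx]; first exact: sub.
  rewrite invf_div in Vyx.
  by rewrite -[x - y]opprB -[- _]mulN1r valuation_idealMl ?(sub y x) // rpredN1.
move=> mx my y0 Vxy; have -> : x - y = (x / y - 1) * y by rewrite mulrBl divfK // mul1r.
by rewrite valuation_idealMl // rpredB ?rpred1.
Qed.

HB.instance Definition _ := GRing.isZmodClosed.Build F mV valuation_ideal_zmod.

Lemma valuation_idealXr x n : x ^+ n \in mV -> x \in mV.
Proof.
rewrite !valuation_idealE; have [//|x0] := eqVneq x 0.
rewrite expf_eq0 (negPf x0) andbF /=; apply: contra => Vxi.
by rewrite -exprVn rpredX.
Qed.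

Lemma valuation_idealX x n : (0 < n)%N -> x \in mV -> x ^+ n \in mV.
Proof.
case: n => // n _ mx; rewrite exprSr valuation_idealMl // rpredX //.
exact: valuation_ideal_sub.
Qed.

Lemma valuation_unitE x : (x \in valuation_unit V) = (x \in V) && (x \notin mV).
Proof. by rewrite valuation_idealE negb_or negbK andbCA. Qed.

Lemma valuation_unit_neq0 x : x \in valuation_unit V -> x != 0.
Proof. by case/and3P. Qed.

Lemma valuation_unit_sub x : x \in valuation_unit V -> x \in V.
Proof. by case/and3P. Qed.

Lemma valuation_unit_div_closed : divr_closed (valuation_unit V).
Proof.
split=> [|x y /and3P[x0 Vx Vxi] /and3P[y0 Vy Vyi]].
  by apply/and3P; rewrite invr1 oner_eq0 rpred1.
by apply/and3P; rewrite invf_div mulf_neq0 ?invr_eq0 ?rpredM.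
Qed.

HB.instance Definition _ :=
  GRing.isDivClosed.Build F (valuation_unit V) valuation_unit_div_closed.

Lemma valuation_unitD x t : x \in valuation_unit V -> t \in mV ->
  x + t \in valuation_unit V.
Proof.
rewrite !valuation_unitE => /andP[Vx mx] mt.
rewrite rpredD ?(valuation_ideal_sub mt) //=.
by apply: contra mx => mxt; rewrite -[x](addrK t) rpredB.
Qed.

Lemma sub_exp_valuation x y n : x \in V -> y \in V ->
  exists2 s, s \in V & x ^+ n - y ^+ n = (x - y) * s.
Proof.
move=> Vx Vy; exists (\sum_(i < n) x ^+ (n.-1 - i) * y ^+ i); last exact: subrXX.
by apply: rpred_sum => i _; rewrite rpredM ?rpredX.
Qed.

End ValuationIdeal.

(** If [x] is not in [Z[x^-1]], some valuation ring omits [x]; if it is, clearing denominators gives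
    a monic integral equation. *)
Lemma Aint_valuation (x : algC) :
  (forall V : valuation_ring algC, x \in V) -> x \in Aint.
Proof.
move=> allV; have [->|x0] := eqVneq x 0; first exact: rpred0.
pose B : {pred algC} := fun z =>
  `[< exists P : {poly int}, z = (map_poly intr P).[x^-1] >].
have B_ring : subring_closed B.
  split.
  - by apply/asboolP; exists 1; rewrite rmorph1 hornerC.
  - move=> _ _ /asboolP[P ->] /asboolP[Q ->]; apply/asboolP.
    by exists (P - Q); rewrite rmorphB !hornerE.
  - move=> _ _ /asboolP[P ->] /asboolP[Q ->]; apply/asboolP.
    by exists (P * Q); rewrite rmorphM hornerM.
have Bxi : x^-1 \in B by apply/asboolP; exists 'X; rewrite map_polyX hornerX.
have [|nBx] := boolP (x^-1^-1 \in B); last first.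
  by have [V] := exists_valuation_ring B_ring Bxi nBx; rewrite invrK allV.
case/asboolP=> P; rewrite invrK => E; set N := size P.
(* Multiplied by [x^N], the equation [x = P(x^-1)] reads [x^(N+1) = r(x)], where [r] has degree at
   most [N]. *)
pose r : {poly int} := \sum_(i < N) P`_i *: 'X^(N - i).
have sr : (size r < size ('X^(N.+1) : {poly int}))%N.
  rewrite size_polyXn !ltnS; apply: leq_trans (size_sum _ _ _) _.
  apply/bigmax_leqP => i _; apply: leq_trans (size_scale_leq _ _) _.
  by rewrite size_polyXn ltnS leq_subr.
apply: (@root_monic_Aint (map_poly intr ('X^(N.+1) - r))).
- rewrite rmorphB /= map_polyXn rootE hornerD hornerN hornerXn subr_eq0.
  rewrite exprS {1}E (@horner_coef_wide _ N) ?size_map_poly_le //; last first.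
    by apply: leq_trans (size_poly _ _) _.
  rewrite mulr_suml rmorph_sum /= horner_sum; apply/eqP/eq_bigr => i _.
  rewrite map_polyZ /= map_polyXn hornerZ hornerXn coef_map /= -mulrA.
  have le_iN : (i <= N)%N by rewrite ltnW.
  have -> : x ^+ N = x ^+ i * x ^+ (N - i) by rewrite -exprD subnKC.
  by rewrite (mulrA _ (x ^+ i)) -exprMn mulVf // expr1n mul1r.
- rewrite monic_map // monicE lead_coefDl ?size_polyN //.
  by rewrite lead_coefXn.
- by apply/polyOverP => i; rewrite coef_map /= rpred_int.
Qed.

(** Otherwise [1/p] would lie in every valuation ring, hence be a rational algebraic integer, that
    is, an integer. *)
Lemma exists_valuation_ring_prime (p : nat) : prime p ->
  exists V : valuation_ring algC, p%:R \in valuation_ideal V.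
Proof.
move=> p_prime; apply: contrapT => none.
have p0 : p%:R != 0 :> algC by rewrite pnatr_eq0 -lt0n prime_gt0.
have : (p%:R)^-1 \in Aint.
  apply: Aint_valuation => V; apply: contrapT => /negP nV.
  by apply: none; exists V; rewrite valuation_idealE nV orbT.
move/Cint_rat_Aint => Zpi; have {}Zpi : (p%:R)^-1 \is a @Num.int algC.
  by apply: Zpi; apply/CratP; exists (p%:R)^-1; rewrite fmorphV rmorph_nat.
have := norm_intr_ge1 Zpi; rewrite invr_eq0 p0 => /(_ isT).
rewrite ger0_norm ?invr_ge0 ?ler0n // invf_ge1 ?ltr0n ?prime_gt0 //.
by rewrite lern1 leqNgt prime_gt1.
Qed.

(** * Prime power exponents *)

(** Since [s C(p^e, s) = p^e C(p^e - 1, s - 1)], if [p] did not divide [C(p^e, s)] then [p^e] would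
    divide [s]. *)
Lemma dvdn_bin_prime_power (p e s : nat) : prime p ->
  (0 < s < p ^ e)%N -> (p %| 'C(p ^ e, s))%N.
Proof.
case: s => // s p_prime /= lt_s; apply: contraLR lt_s => pC; rewrite -leqNgt.
apply: dvdn_leq => //; rewrite -(@Gauss_dvdl _ _ 'C(p ^ e, s.+1)).
  by rewrite -mul_bin_diag dvdn_mulr.
by apply: coprimeXl; rewrite prime_coprime.
Qed.

(** The middle binomial coefficients are divisible by [p]. The factor [t] is kept in the error term
    so that in [orbit0_diff_prime] the error is a multiple of the difference. *)
Lemma expD_prime_power (F : fieldType) (V : valuation_ring F) (p e : nat) (x t : F) :
  prime p -> x \in V -> t \in V ->
  exists2 v, v \in V &
    (x + t) ^+ (p ^ e) = x ^+ (p ^ e) + t ^+ (p ^ e) + p%:R * t * v.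
Proof.
move=> p_prime Vx Vt; have : (0 < p ^ e)%N by rewrite expn_gt0 prime_gt0.
have pC s : (s.+1 < p ^ e)%N -> (p %| 'C(p ^ e, s.+1))%N.
  by move=> lt_s; rewrite dvdn_bin_prime_power.
case E : (p ^ e)%N pC => [|N] // pC _.
exists (\sum_(i < N) ('C(N.+1, i.+1) %/ p)%:R * (x ^+ (N - i) * t ^+ i)).
  by apply: rpred_sum => i _; rewrite rpredM ?rpred_nat // rpredM ?rpredX.
rewrite exprDn big_ord_recl big_ord_recr /= bin0 binn !mulr1n expr0 mulr1.
rewrite subn0 subnn expr0 mul1r addrA addrAC; congr (_ + _).
rewrite mulr_sumr; apply: eq_bigr => i _; rewrite -[bump 0 i]/(i.+1) subSS.
have /dvdnP[k Ek] := pC i (ltn_ord i : (i.+1 < N.+1)%N).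
rewrite Ek mulnK ?prime_gt0 // -mulr_natr natrM exprS; ring.
Qed.

(** * The critical orbit in a valuation ring *)

Definition orbit0 (R : nzRingType) (d : nat) (c : R) (i : nat) : R :=
  iter i (unicritical d c) 0.

Lemma orbit0S (R : nzRingType) d (c : R) i : orbit0 d c i.+1 = orbit0 d c i ^+ d + c.
Proof. by []. Qed.

Lemma orbit0_periodic (R : nzRingType) d (c : R) i k s :
  orbit0 d c (i + k) = orbit0 d c i -> (i <= s)%N -> orbit0 d c (s + k) = orbit0 d c s.
Proof.
move=> E /subnKC <-; elim: (s - i)%N => [|t IH]; first by rewrite addn0.
by rewrite addnS addSn !orbit0S IH.
Qed.

Lemma orbit0_periodicM (R : nzRingType) d (c : R) i k s t :
  orbit0 d c (i + k) = orbit0 d c i -> (i <= s)%N ->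
  orbit0 d c (s + t * k) = orbit0 d c s.
Proof.
move=> E le_is; elim: t => [|t IH]; first by rewrite mul0n addn0.
by rewrite mulSnr addnA (orbit0_periodic E) // (leq_trans le_is) ?leq_addr.
Qed.

Lemma orbit0_horner d (c : algC) i : (crit_orbit d i).[c] = orbit0 d c i.
Proof.
elim: i => [|i IH]; first by rewrite horner0.
by rewrite orbit0S /crit_orbit iterS -/(crit_orbit d i) !hornerE IH.
Qed.

Section LocalOrbit.

Variables (F : fieldType) (V : valuation_ring F) (d : nat) (c : F).
Hypotheses (d_gt1 : (1 < d)%N) (Vc : c \in V).
Local Notation mV := (valuation_ideal V).
Local Notation a := (orbit0 d c).

Lemma orbit0_valuation i : a i \in V.
Proof. by elim: i => [|i IH]; rewrite ?rpred0 // orbit0S rpredD ?rpredX. Qed.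

(** Since [x - y] divides [x^d - y^d], each iteration multiplies the difference by an element of
    [V]. *)
Lemma orbit0_diff_dvd i k t :
  exists2 s, s \in V & a (i + t + k) - a (i + t) = (a (i + k) - a i) * s.
Proof.
elim: t => [|t [s Vs E]]; first by exists 1; rewrite ?rpred1 // addn0 mulr1.
have [s1 Vs1 E1] := sub_exp_valuation d (orbit0_valuation (i + t + k))
                                        (orbit0_valuation (i + t)).
exists (s * s1); first exact: rpredM.
by rewrite addnS addSn !orbit0S opprD addrACA subrr addr0 E1 E mulrA.
Qed.

Lemma orbit0_diff_dvd0 i k : exists2 s, s \in V & a (i + k) - a i = a k * s.
Proof. by have [s Vs] := orbit0_diff_dvd 0 k i; rewrite subr0 => E; exists s. Qed.

(** The orbit starts at [0], so [a_(1+k) - a_1] is exactly [a_k^d] with [d >= 2], and it divides all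
    later differences. *)
Lemma orbit0_diff_dvd1 i k : (0 < i)%N ->
  exists2 s, s \in V & a (i + k) - a i = a k ^+ 2 * s.
Proof.
case: i => // i _; have [s Vs] := orbit0_diff_dvd 1 k i.
have -> : a (1 + k) - a 1 = a k ^+ d.
  rewrite add1n !orbit0S opprD addrACA subrr addr0 [orbit0 d c 0]/(0 : F) expr0n.
  by case: d d_gt1 => // d' _; rewrite subr0.
have -> : a k ^+ d = a k ^+ 2 * a k ^+ (d - 2) by rewrite -exprD subnKC.
rewrite add1n -mulrA => ->.
by exists (a k ^+ (d - 2) * s) => //; rewrite rpredM ?rpredX ?orbit0_valuation.
Qed.

(** By [orbit0_diff_dvd1], adding [q] to a positive multiple of [q] changes the value only by a
    multiple of [a_q^2]; hence [a_(sq)] is [a_q] times an element congruent to [1]. *)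
Lemma orbit0_multiple q s : a q \in mV -> (0 < s)%N ->
  exists2 u, u \in valuation_unit V & a (s * q) = u * a q.
Proof.
move=> mq; case: s => // s _.
have [v Vv E] : exists2 v, v \in V & a (s.+1 * q) = (1 + a q * v) * a q.
  elim: s => [|s [v Vv E]].
    by exists 0; rewrite ?rpred0 // mul1n mulr0 addr0 mul1r.
  have [->|q0] := posnP q.
    by exists 0; rewrite ?rpred0 // muln0 -[a 0]/(0 : F) !mulr0.
  have sq0 : (0 < s.+1 * q)%N by rewrite muln_gt0.
  have [s1 Vs1 E1] := orbit0_diff_dvd1 q sq0.
  exists (v + s1); first exact: rpredD.
  rewrite mulSnr -[LHS](subrK (a (s.+1 * q))) E1 E; ring.
exists (1 + a q * v) => //.
by rewrite valuation_unitD ?rpred1 // valuation_idealMr.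
Qed.

(** Here [q] is the period of [0] in the residue field: shifting an index by a multiple of [q]
    changes the value by an element of the maximal ideal. *)
Lemma orbit0_ideal k : (0 < k)%N -> a k \in mV ->
  exists2 q, (0 < q)%N & forall i, (a i \in mV) = (q %| i)%N.
Proof.
move=> k0 mk; have ex : exists k, (0 < k)%N && (a k \in mV) by exists k; rewrite k0.
case: (ex_minnP ex) => q /andP[q0 mq] q_min; exists q => // i.
have shift s r : (a (r + s * q) \in mV) = (a r \in mV).
  case: s => [|s]; first by rewrite mul0n addn0.
  have [u uu Eu] := orbit0_multiple mq (ltn0Sn s).
  have [v Vv E] := orbit0_diff_dvd0 r (s.+1 * q).
  have msq : a (s.+1 * q) * v \in mV.
    by rewrite Eu mulrC mulrA valuation_idealMl ?rpredM // valuation_unit_sub.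
  apply/idP/idP => [m1|m1].
    by rewrite -[a r](subKr (a (r + s.+1 * q))) E rpredB.
  by rewrite -[a (r + _)](subrK (a r)) E rpredD.
rewrite (divn_eq i q) addnC shift dvdn_addl ?dvdn_mull //.
have [->|r0] := posnP (i %% q); first by rewrite dvdn0 rpred0.
rewrite gtnNdvd ?ltn_pmod //; apply/negP => mr.
by have := q_min _ (introT andP (conj r0 mr)); rewrite leqNgt ltn_pmod.
Qed.

End LocalOrbit.

(** * Roots of unity of order a power of [p], and congruences above [p] *)

Section RootOfUnity.

Variables (F : fieldType) (V : valuation_ring F) (p e d : nat) (zeta : F).
Hypotheses (p_prime : prime p) (e_gt0 : (0 < e)%N) (dE : d = (p ^ e)%N).
Hypotheses (zeta_unity : zeta ^+ d = 1) (zeta_neq1 : zeta != 1).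
Local Notation mV := (valuation_ideal V).

Lemma prime_power_gt1 : (1 < d)%N.
Proof. by rewrite dE -(exp1n e) ltn_exp2r ?prime_gt1. Qed.

Lemma root_of_unity_valuation : zeta \in V.
Proof.
have d0 : (0 < d)%N by rewrite ltnW ?prime_power_gt1.
apply: (@monic_root_valuation _ _ ('X^d - 1)).
- by rewrite monicE lead_coefDl ?lead_coefXn // size_polyN size_poly1 size_polyXn ltnS.
- by rewrite rpredB ?polyOverXn ?rpred1.
- by rewrite rootE !hornerE zeta_unity subrr.
Qed.

(** Some power [w] of [zeta] has order [p]. Then [p] is the sum of the [1 - w^i] for [i < p], all
    divisible by [1 - w] and hence by [1 - zeta]. *)
Lemma prime_dvd_one_sub : exists2 w, w \in V & p%:R = (1 - zeta) * w.
Proof.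
have Vz := root_of_unity_valuation.
have ex : exists s, zeta ^+ (p ^ s) == 1 by exists e; rewrite -dE zeta_unity.
(* The least exponent is positive because [zeta] is not [1]; one below it, [w] is not [1] but [w^p]
   is. *)
case: (ex_minnP ex) => [[|s]]; first by rewrite expr1 (negPf zeta_neq1).
move=> /eqP E s_min; pose w := zeta ^+ (p ^ s).
have w1 : w != 1 by apply/negP => /s_min; rewrite ltnn.
have wp : w ^+ p = 1 by rewrite -exprM -expnSr.
have Vw : w \in V by rewrite rpredX.
have sum0 : \sum_(i < p) w ^+ i = 0.
  apply/eqP; have /eqP := subrX1 w p; rewrite wp subrr eq_sym mulf_eq0.
  by rewrite subr_eq0 (negPf w1).
have [v Vv Ev] : exists2 v, v \in V & 1 - w = (1 - zeta) * v.
  have [v Vv] := sub_exp_valuation (p ^ s) (rpred1 _) Vz.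
  by rewrite expr1n => E1; exists v.
exists (v * \sum_(i < p) \sum_(j < i) w ^+ j).
  by rewrite rpredM // rpred_sum // => i _; rewrite rpred_sum // => j _; rewrite rpredX.
rewrite mulrA -Ev mulr_sumr -[LHS]subr0 -[in LHS]sum0.
have -> : p%:R = \sum_(i < p) 1 :> F by rewrite sumr_const card_ord.
rewrite -sumrB; apply: eq_bigr => i _.
by rewrite -[LHS]opprB subrX1 -mulNr opprB.
Qed.

Lemma one_sub_unit : p%:R \notin mV -> 1 - zeta \in valuation_unit V.
Proof.
move=> np; have [w Vw E] := prime_dvd_one_sub.
rewrite valuation_unitE rpredB ?rpred1 ?root_of_unity_valuation //=.
by apply: contra np => mz; rewrite E valuation_idealMr.
Qed.

(** Expanding [1 = (zeta + (1 - zeta))^d] and cancelling [zeta^d = 1] leaves [(1 - zeta)^d] as a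
    multiple of [p]. *)
Lemma one_sub_ideal : p%:R \in mV -> 1 - zeta \in mV.
Proof.
move=> mp; have Vz := root_of_unity_valuation; apply: (@valuation_idealXr _ _ _ d).
have V1z : 1 - zeta \in V by rewrite rpredB ?rpred1.
have [v Vv] := expD_prime_power e p_prime Vz V1z.
rewrite -dE addrC subrK expr1n zeta_unity -addrA => /eqP.
rewrite -[X in X == _]addr0 (inj_eq (addrI _)) eq_sym addr_eq0 => /eqP ->.
by rewrite rpredN -mulrA valuation_idealMr ?rpredM.
Qed.

Variable c : F.
Hypothesis Vc : c \in V.
Local Notation a := (orbit0 d c).

Lemma orbit0_diff_prime i k : exists2 v, v \in V &
  a (i.+1 + k) - a i.+1 = (a (i + k) - a i) ^+ d + p%:R * (a (i + k) - a i) * v.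
Proof.
have Va := orbit0_valuation d Vc.
have [v Vv] := expD_prime_power e p_prime (Va i) (rpredB (Va (i + k)%N) (Va i)).
rewrite addrC subrK -dE => E; exists v => //.
by rewrite addSn !orbit0S opprD addrACA subrr addr0 E addrAC [X in X - _ + _]addrC addrK.
Qed.

(** Modulo the maximal ideal each iteration raises the difference to the power [d], so membership
    passes both ways along the orbit, down to [a_k - a_0 = a_k]. *)
Lemma orbit0_diff_ideal i k : p%:R \in mV ->
  (a (i + k) - a i \in mV) = (a k \in mV).
Proof.
move=> mp; elim: i => [|i <-]; first by rewrite subr0.
have [v Vv ->] := orbit0_diff_prime i k.
have VD : a (i + k) - a i \in V by rewrite rpredB ?orbit0_valuation.
have m2 : p%:R * (a (i + k) - a i) * v \in mV by rewrite -mulrA valuation_idealMr ?rpredM.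
apply/idP/idP => [m1|m1].
  apply: (@valuation_idealXr _ _ _ d).
  by rewrite -[_ ^+ d](addrK (p%:R * (a (i + k) - a i) * v)) rpredB.
by rewrite rpredD // valuation_idealX // ltnW ?prime_power_gt1.
Qed.

End RootOfUnity.

(* The parameters [c] whose critical orbit has preperiod [M + 1] and exact period [n],
   with [zeta] the quotient of the two preimages [a_(M+n)] and [a_M] of [a_(M+1)].
   In the notation of [misiurewicz], [M] is [m - 1]. *)
Definition misiurewicz_point (F : fieldType) (d M n : nat) (zeta c : F) :=
  [/\ orbit0 d c (M + n) = zeta * orbit0 d c M, orbit0 d c M != 0 &
    forall k, orbit0 d c (M.+1 + k) = orbit0 d c M.+1 -> (n %| k)%N].

(** * Values at a Misiurewicz parameter, up to units *)

Section MisiurewiczPoint.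

Variables (F : fieldType) (p e d M n : nat) (zeta c : F).
Hypotheses (p_prime : prime p) (e_gt0 : (0 < e)%N) (dE : d = (p ^ e)%N).
Hypotheses (zeta_unity : zeta ^+ d = 1) (zeta_neq1 : zeta != 1).
Hypotheses (M_gt0 : (0 < M)%N) (n_gt0 : (0 < n)%N).
Hypothesis cM : misiurewicz_point d M n zeta c.
Local Notation a := (orbit0 d c).

Let d_gt1 : (1 < d)%N := prime_power_gt1 p_prime e_gt0 dE.
Let aMn : a (M + n) = zeta * a M. Proof. by case: cM. Qed.
Let aM0 : a M != 0. Proof. by case: cM. Qed.
Let n_min k : a (M.+1 + k) = a M.+1 -> (n %| k)%N. Proof. by case: cM => _ _; apply. Qed.

Let one_sub_neq0 : 1 - zeta != 0. Proof. by rewrite subr_eq0 eq_sym. Qed.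

Lemma misiurewicz_point_period : a (M.+1 + n) = a M.+1.
Proof. by rewrite addSn !orbit0S aMn exprMn zeta_unity mul1r. Qed.

Lemma misiurewicz_point_late s k : (M < s)%N -> (n %| k)%N -> a (s + k) = a s.
Proof.
by move=> lt_Ms /dvdnP[t ->]; apply: orbit0_periodicM lt_Ms; exact: misiurewicz_point_period.
Qed.

Lemma misiurewicz_point_at k : (0 < k)%N -> (n %| k)%N -> a (M + k) = zeta * a M.
Proof.
move=> k0 /dvdnP[[|t] Ek]; first by rewrite Ek in k0.
by rewrite Ek mulSn addnA misiurewicz_point_late ?dvdn_mull // -addn1 leq_add2l.
Qed.

(** If [a_i = 0], the orbit is purely periodic and [a_(M + n i) = a_M]; but this value is also
    [zeta * a_M], with [a_M] nonzero. *)
Lemma misiurewicz_point_neq0 i : (0 < i)%N -> a i != 0.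
Proof.
move=> i0; apply/eqP => ai0.
have E : a (0 + i) = a 0 by rewrite add0n ai0.
have := orbit0_periodicM n E (leq0n M).
rewrite misiurewicz_point_at ?dvdn_mulr ?muln_gt0 ?n_gt0 //.
move/eqP; rewrite -subr_eq0 -{2}[a M]mul1r -mulrBl mulf_eq0 (negPf aM0) orbF.
by rewrite -oppr_eq0 opprB (negPf one_sub_neq0).
Qed.

Lemma misiurewicz_delta_late J k : (M < J)%N -> (n %| k)%N ->
  a (J + k) - zeta * a J = (1 - zeta) * a J.
Proof. by move=> lt_MJ nk; rewrite misiurewicz_point_late // mulrBl mul1r. Qed.

(** A zero would make [k] a period from index [J + 1] on. Comparison with the period [n] at the
    common multiple [n * k] gives [zeta * x = x] for [x = a_M] if [J < M], and for [x = a_J] if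
    [J > M]. *)
Lemma misiurewicz_delta_neq0 J k : J != M -> (0 < J)%N -> (0 < k)%N ->
  a (J + k) - zeta * a J != 0.
Proof.
move=> neJM J0 k0; rewrite subr_eq0; apply/eqP => E.
have aJ0 := misiurewicz_point_neq0 J0.
have Ek : a (J.+1 + k) = a J.+1 by rewrite addSn !orbit0S E exprMn zeta_unity mul1r.
suff [x x0 /eqP] : exists2 x, x != 0 & zeta * x = x.
  by rewrite -subr_eq0 -{2}[x]mul1r -mulrBl mulf_eq0 (negPf x0) orbF
             subr_eq0 (negPf zeta_neq1).
have [lt_JM|lt_MJ|/eqP] := ltngtP J M; last by rewrite (negPf neJM).
  exists (a M) => //; rewrite -(@misiurewicz_point_at (n * k)) ?dvdn_mulr ?muln_gt0 ?n_gt0 //.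
  exact: orbit0_periodicM Ek lt_JM.
exists (a J) => //; rewrite -E.
have lt1 : (J < J + k)%N by rewrite -addn1 leq_add2l.
have [n' En] : exists n', n = n'.+1 by exists n.-1; rewrite prednK.
rewrite -(orbit0_periodicM n' Ek lt1) -addnA -mulSn -En.
by rewrite misiurewicz_point_late // dvdn_mulr.
Qed.

Variable V : valuation_ring F.
Hypothesis Vc : c \in V.
Local Notation mV := (valuation_ideal V).
Let Va i : a i \in V := orbit0_valuation d Vc i.
Let Vz : zeta \in V := root_of_unity_valuation V p_prime e_gt0 dE zeta_unity.

Section AwayFromP.

Hypothesis np : p%:R \notin mV.
Let uz : 1 - zeta \in valuation_unit V :=
  one_sub_unit p_prime e_gt0 dE zeta_unity zeta_neq1 np.

(** Otherwise [0] has a residual period [q]. Then [(zeta - 1) * a_M = a_(M + n q) - a_M] is a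
    multiple of [a_q^2], and so is [a_M] because [1 - zeta] is a unit. Hence [q] divides [M], which
    makes [a_M] associated to [a_q]: a contradiction. *)
Lemma misiurewicz_orbit_unit i : (0 < i)%N -> a i \in valuation_unit V.
Proof.
move=> i0; rewrite valuation_unitE Va /=; apply/negP => mi.
have [q q0 qE] := orbit0_ideal d_gt1 Vc i0 mi.
have mq : a q \in mV by rewrite qE.
have [u uu Eu] := orbit0_multiple d_gt1 Vc mq n_gt0.
have [s Vs] := orbit0_diff_dvd1 d_gt1 Vc (n * q) M_gt0.
rewrite misiurewicz_point_at ?dvdn_mulr ?muln_gt0 ?n_gt0 // Eu => E.
have {}E : a M = a q ^+ 2 * (- (1 - zeta)^-1 * u ^+ 2 * s).
  apply: (mulfI one_sub_neq0).
  have -> : (1 - zeta) * (a q ^+ 2 * (- (1 - zeta)^-1 * u ^+ 2 * s)) =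
    - ((u * a q) ^+ 2 * s) by field.
  by rewrite -E; ring.
have Vw : - (1 - zeta)^-1 * u ^+ 2 * s \in V.
  have Vi : (1 - zeta)^-1 \in V by case/and3P: uz.
  by rewrite rpredM // rpredM ?rpredX ?rpredN // valuation_unit_sub.
have /dvdnP[t Et] : (q %| M)%N.
  by rewrite -qE E expr2 -mulrA (valuation_idealMr mq) // (rpredM (Va q) Vw).
have t0 : (0 < t)%N by rewrite lt0n; apply: contraTneq M_gt0 => t0; rewrite Et t0.
have [v uv Ev] := orbit0_multiple d_gt1 Vc mq t0.
have aq0 : a q != 0 by apply: misiurewicz_point_neq0.
have Ev1 : v = a q * (- (1 - zeta)^-1 * u ^+ 2 * s).
  by apply: (mulIf aq0); rewrite -Ev -Et E; ring.
have := uv; rewrite valuation_unitE => /andP[_ /negP]; apply.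
by rewrite Ev1 valuation_idealMr.
Qed.

(** The argument of [misiurewicz_delta_neq0] with congruences in place of equalities: it would put
    [(1 - zeta) * a_i], a unit, in the maximal ideal, for [i = M] or [i = J]. *)
Lemma misiurewicz_delta_unit_away J k : J != M -> (0 < J)%N -> (0 < k)%N ->
  a (J + k) - zeta * a J \in valuation_unit V.
Proof.
move=> neJM J0 k0; rewrite valuation_unitE rpredB ?rpredM //=; apply/negP => mD.
have step t : a (J.+1 + t + k) - a (J.+1 + t) \in mV.
  have [s Vs ->] := orbit0_diff_dvd d Vc J.+1 k t.
  rewrite valuation_idealMr // addSn !orbit0S opprD addrACA subrr addr0.
  have [s1 Vs1] := sub_exp_valuation d (Va (J + k)) (rpredM Vz (Va J)).
  by rewrite exprMn zeta_unity mul1r => ->; rewrite valuation_idealMr.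
have steps t i : (J < i)%N -> a (i + t * k) - a i \in mV.
  move=> lt_Ji; elim: t => [|t IH]; first by rewrite addn0 subrr rpred0.
  rewrite -[X in X \in _](subrKA (a (i + t * k))) rpredD // mulSnr addnA.
  have -> : (i + t * k = J.+1 + (i + t * k - J.+1))%N by rewrite subnKC // ltn_addr.
  exact: step.
suff [i i0 mi] : exists2 i, (0 < i)%N & (1 - zeta) * a i \in mV.
  have := rpredM uz (misiurewicz_orbit_unit i0).
  by rewrite valuation_unitE mi andbF.
have [lt_JM|lt_MJ|/eqP] := ltngtP J M; last by rewrite (negPf neJM).
  exists M => //; have := steps n M lt_JM.
  rewrite misiurewicz_point_at ?dvdn_mulr ?muln_gt0 ?n_gt0 //.
  by rewrite -rpredN opprB mulrBl mul1r.
exists J => //; have lt1 : (J < J + k)%N by rewrite -addn1 leq_add2l.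
have [n' En] : exists n', n = n'.+1 by exists n.-1; rewrite prednK.
have := steps n' _ lt1; rewrite -addnA -mulSn -En misiurewicz_point_late ?dvdn_mulr //.
by move=> mD'; have := rpredD mD' mD; rewrite subrKA mulrBl mul1r.
Qed.

End AwayFromP.

Section AboveP.

Hypothesis mp : p%:R \in mV.
Let mz : 1 - zeta \in mV := one_sub_ideal p_prime e_gt0 dE zeta_unity mp.

Let an_ideal : a n \in mV.
Proof.
rewrite -(orbit0_diff_ideal p_prime e_gt0 dE Vc M n mp) aMn.
have -> : zeta * a M - a M = - ((1 - zeta) * a M) by ring.
by rewrite rpredN valuation_idealMr.
Qed.

(* If [q] is the period of [0] in the residue field, then [a (i + q) - a i] is
   multiplied by an element of the maximal ideal at each step, while it is periodic
   in [i] for large [i]: it must vanish. *)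
Lemma misiurewicz_orbit_ideal i : (a i \in mV) = (n %| i)%N.
Proof.
have [q q0 qE] := orbit0_ideal d_gt1 Vc n_gt0 an_ideal; rewrite qE.
have qn : (q %| n)%N by rewrite -qE an_ideal.
suff nq : (n %| q)%N.
  by apply/idP/idP; apply: dvdn_trans.
apply: n_min; apply/eqP; rewrite -subr_eq0; apply/eqP.
have contr s : exists2 t, t \in mV & a (s.+1 + q) - a s.+1 = (a (s + q) - a s) * t.
  have [v Vv ->] := orbit0_diff_prime p_prime dE Vc s q.
  exists ((a (s + q) - a s) ^+ d.-1 + p%:R * v); last first.
    have Ed x : x ^+ d = x * x ^+ d.-1 :> F by rewrite -exprS prednK // ltnW.
    by rewrite Ed; ring.
  rewrite rpredD ?valuation_idealMr // valuation_idealX //.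
    by case: d d_gt1 => [|[]].
  by rewrite (orbit0_diff_ideal p_prime e_gt0 dE Vc) // qE.
have contrs s : exists2 t, t \in mV &
    a (M.+1 + s.+1 + q) - a (M.+1 + s.+1) = (a (M.+1 + q) - a M.+1) * t.
  elim: s => [|s [t mt E]]; first by rewrite addn1; apply: contr.
  have [t1 mt1] := contr (M.+1 + s.+1)%N; rewrite -addnS E => E1.
  by exists (t * t1); rewrite ?valuation_idealMl ?valuation_ideal_sub // E1 mulrA.
have [t mt] := contrs n.-1; rewrite prednK // addnAC.
rewrite !(@misiurewicz_point_late _ n) // ?ltnS ?leq_addr //.
move/eqP; rewrite -{1}[_ - _]mulr1 -subr_eq0 -mulrBr mulf_eq0 => /orP[/eqP //|].
rewrite subr_eq0 => /eqP t1; have := valuation_ideal1 V.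
by rewrite t1 mt.
Qed.

Let an_multiple k : (0 < k)%N -> (n %| k)%N ->
  exists2 u, u \in valuation_unit V & a k = u * a n.
Proof.
move=> k0 /dvdnP[s Es]; rewrite Es; apply: orbit0_multiple => //.
by case: s Es => // Es; rewrite Es in k0.
Qed.

(** Modulo the maximal ideal [zeta] is [1], which leaves [a_(J+k) - a_J]; it is in the ideal only if
    [a_k] is. *)
Lemma misiurewicz_delta_unit_above J k : ~~ (n %| k)%N ->
  a (J + k) - zeta * a J \in valuation_unit V.
Proof.
move=> nk; have -> : a (J + k) - zeta * a J = (a (J + k) - a J) + (1 - zeta) * a J by ring.
rewrite valuation_unitD ?valuation_idealMr // valuation_unitE rpredB //=.
by rewrite (orbit0_diff_ideal p_prime e_gt0 dE Vc) // misiurewicz_orbit_ideal.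
Qed.

Section Multiple.

Variable k : nat.
Hypotheses (k_gt0 : (0 < k)%N) (nk : (n %| k)%N).

Let mk : a k \in mV. Proof. by rewrite misiurewicz_orbit_ideal. Qed.
Let ak0 : a k != 0. Proof. exact: misiurewicz_point_neq0. Qed.

(** Either [n] divides [M] and both [a_k] and [a_M] are associated to [a_n], or [a_M] is a unit. *)
Let dvd_aM : exists2 v, v \in V & a k = a M * v.
Proof.
have [nM|nM] := boolP (n %| M)%N; last first.
  exists (a k / a M); last by rewrite mulrC divfK.
  rewrite rpredM //.
  have : a M \in valuation_unit V by rewrite valuation_unitE Va misiurewicz_orbit_ideal.
  by case/and3P.
have [u uu Eu] := an_multiple k_gt0 nk; have [v uv Ev] := an_multiple M_gt0 nM.
exists (u / v); first by rewrite valuation_unit_sub // rpred_div.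
by rewrite Ev Eu; field; rewrite (valuation_unit_neq0 uv).
Qed.

(* The second term of [orbit0_diff_prime] is negligible as long as the index stays below
   [M]: otherwise [p * a k ^ 2] would divide [(1 - zeta) * a M]. *)
Lemma misiurewicz_diff_exp i : (i <= M)%N ->
  exists2 u, u \in valuation_unit V & a (i + k) - a i = u * a k ^+ (d ^ i).
Proof.
elim: i => [|i IH] le_iM.
  by exists 1; rewrite ?rpred1 // mul1r subr0.
have [u uu Eu] := IH (ltnW le_iM).
have [v Vv Ev] := orbit0_diff_prime p_prime dE Vc i k.
have u0 := valuation_unit_neq0 uu.
have D0 : a (i + k) - a i != 0 by rewrite Eu mulf_neq0 ?expf_neq0.
set D := a (i + k) - a i in Eu Ev D0.
(* The case [i = 0] is apart because [d^i] is then only [1], too small for the argument below; but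
   the step from index [0] is exact. *)
have [i0|i_gt0] := posnP i.
  exists 1; rewrite ?rpred1 // mul1r i0 expn1 add1n !orbit0S opprD addrACA subrr addr0.
  by rewrite -[orbit0 d c 0]/(0 : F) expr0n; case: d d_gt1 => // d' _; rewrite subr0.
have Ed x : x ^+ d = x ^+ d.-1 * x :> F by rewrite -exprSr prednK // ltnW.
have small : p%:R / D ^+ d.-1 \in mV.
  apply: contraT; rewrite valuation_idealE negb_or negbK invf_div => /andP[p0 Vq].
  have {}p0 : p%:R != 0 :> F by apply: contraNneq p0 => ->; rewrite mul0r.
  have [w Vw Ew] := prime_dvd_one_sub V p_prime e_gt0 dE zeta_unity zeta_neq1.
  have [s Vs] := orbit0_diff_dvd d Vc i.+1 k (M - i.+1).
  have [v1 Vv1 Ev1] := dvd_aM.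
  rewrite subnKC // misiurewicz_point_at // Ev => E.
  pose r := - (w * (D ^+ d.-1 / p%:R + v) * s).
  have Vr : r \in V by rewrite rpredN !rpredM // rpredD.
  have EM : a M = D * r.
    apply: (mulfI one_sub_neq0).
    have -> : (1 - zeta) * a M = - (zeta * a M - a M) by ring.
    have -> : (1 - zeta) * (D * r) = - ((1 - zeta) * w * D * (D ^+ d.-1 / p%:R + v) * s).
      by rewrite /r; ring.
    by rewrite E -Ew Ed; field.
  (* As [D] is a unit times [a_k^(d^i)], the multiple [a_M] of [D] is a multiple of [a_k^2]. But
     [a_M] divides [a_k], so [a_k] would divide [1]. *)
  have le2 : (2 <= d ^ i)%N by rewrite (leq_trans d_gt1) // -{1}(expn1 d) leq_exp2l.
  have E1 : 1 = a k * (u * a k ^+ (d ^ i - 2) * r * v1).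
    apply: (mulfI ak0); rewrite mulr1 {1}Ev1 EM Eu -{1}(subnKC le2) exprD; ring.
  have := valuation_ideal1 V; rewrite E1 valuation_idealMr //.
  by rewrite !rpredM ?rpredX // valuation_unit_sub.
exists ((1 + v * (p%:R / D ^+ d.-1)) * u ^+ d).
  by rewrite rpredM ?rpredX // valuation_unitD ?rpred1 // valuation_idealMl.
have -> : (1 + v * (p%:R / D ^+ d.-1)) * u ^+ d * a k ^+ (d ^ i.+1) =
    (1 + v * (p%:R / D ^+ d.-1)) * D ^+ d.
  by rewrite -mulrA; congr (_ * _); rewrite Eu exprMn -exprM expnSr.
by rewrite Ev Ed; field; rewrite expf_neq0.
Qed.

(** The quantity is [(a_(J+k) - a_J) + (1 - zeta) * a_J]. By [misiurewicz_diff_exp] at [J] the first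
    term has the claimed form; at [M] it bounds [1 - zeta] and makes the second term of higher
    order. *)
Lemma misiurewicz_delta_early J : (0 < J < M)%N ->
  exists2 u, u \in valuation_unit V & a (J + k) - zeta * a J = u * a n ^+ (d ^ J).
Proof.
case/andP=> J0 lt_JM.
have [w uw Ew] := an_multiple k_gt0 nk.
have [u uu Eu] := misiurewicz_diff_exp (ltnW lt_JM).
have [uM uuM EuM] := misiurewicz_diff_exp (leqnn M).
have [v Vv Ev] := dvd_aM.
rewrite misiurewicz_point_at // in EuM.
(* Of the two spare factors [a_k], one is traded for [a_M] and cancelled, the other puts the
   quotient in the maximal ideal. *)
have lt_dd : (d ^ J + 2 <= d ^ M)%N.
  apply: leq_trans (_ : d ^ J.+1 <= _)%N; last by rewrite leq_exp2l.
  have le2 : (2 <= d ^ J)%N by rewrite (leq_trans d_gt1) // -{1}(expn1 d) leq_exp2l.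
  apply: leq_trans (_ : 2 * d ^ J <= _)%N; first by rewrite mul2n -addnn leq_add2l.
  by rewrite expnS leq_mul2r d_gt1 orbT.
pose N := (d ^ M - (d ^ J + 2))%N.
have Ez : 1 - zeta = - (uM * v * a k * a k ^+ N) * a k ^+ (d ^ J).
  apply: (mulIf aM0).
  have -> : (1 - zeta) * a M = - (zeta * a M - a M) by ring.
  have -> : zeta * a M - a M = uM * a k ^+ N * a k ^+ (d ^ J) * a k * (a M * v).
    rewrite EuM -Ev -(subnKC lt_dd) -/N !exprD expr2; ring.
  by ring.
exists ((u - uM * v * a k * a k ^+ N * a J) * w ^+ (d ^ J)).
  rewrite rpredM ?rpredX // valuation_unitD //.
  have -> : - (uM * v * a k * a k ^+ N * a J) = a k * - (uM * v * a k ^+ N * a J) by ring.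
  by rewrite valuation_idealMr // rpredN !rpredM ?rpredX // valuation_unit_sub.
have -> : a (J + k) - zeta * a J = (a (J + k) - a J) + (1 - zeta) * a J by ring.
by rewrite Ez Eu Ew !exprMn; ring.
Qed.

End Multiple.
End AboveP.

(** A form valid at every [V], ready for [prod_moebius_val]; away from [p] both sides are units,
    [a_n] included. *)
Lemma misiurewicz_orbit_val k : (0 < k)%N ->
  exists2 u, u \in valuation_unit V & a k = u * (if (n %| k)%N then a n else 1).
Proof.
move=> k0; have [mp|np] := boolP (p%:R \in mV); last first.
  exists (a k / (if (n %| k)%N then a n else 1)).
    rewrite rpred_div ?misiurewicz_orbit_unit //.
    by case: ifP; rewrite ?rpred1 ?misiurewicz_orbit_unit.
  by rewrite divfK //; case: ifP; rewrite ?oner_eq0 ?misiurewicz_point_neq0.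
case: ifP => nk; last first.
  by exists (a k); rewrite ?mulr1 // valuation_unitE Va misiurewicz_orbit_ideal ?nk.
have /dvdnP[s Es] := nk; rewrite Es; apply: orbit0_multiple => //.
  by rewrite misiurewicz_orbit_ideal.
by case: s Es => // Es; rewrite Es in k0.
Qed.

Lemma misiurewicz_delta_val J k : J != M -> (0 < J)%N -> (0 < k)%N ->
  exists2 u, u \in valuation_unit V & a (J + k) - zeta * a J =
    u *
      (if (n %| k)%N then if (J < M)%N then a n ^+ (d ^ J) else (1 - zeta) * a J else 1).
Proof.
move=> neJM J0 k0.
have [nk|nk] := boolP (n %| k)%N; last first.
  exists (a (J + k) - zeta * a J); last by rewrite mulr1.
  have [mp|np] := boolP (p%:R \in mV); first exact: misiurewicz_delta_unit_above.
  exact: misiurewicz_delta_unit_away.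
case: ifP => lt_JM; last first.
  exists 1; first exact: rpred1.
  by rewrite mul1r misiurewicz_delta_late // ltn_neqAle eq_sym neJM leqNgt lt_JM.
have [mp|np] := boolP (p%:R \in mV).
  by apply: misiurewicz_delta_early; rewrite ?J0.
exists ((a (J + k) - zeta * a J) / a n ^+ (d ^ J)).
  by rewrite rpred_div ?misiurewicz_delta_unit_away // rpredX ?misiurewicz_orbit_unit.
by rewrite divfK // expf_neq0 // misiurewicz_point_neq0.
Qed.

End MisiurewiczPoint.

(** * Moebius inversion *)

Lemma moebius_dvd (p k : nat) : prime p -> (0 < k)%N -> (p %| k)%N ->
  moebius (p * k) = 0.
Proof.
move=> p_prime k0 pk; rewrite /moebius; case: ifP => // /allP /(_ p).
rewrite mem_primes p_prime muln_gt0 (prime_gt0 p_prime) // k0 dvdn_mulr // => /(_ isT).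
by rewrite lognM ?(prime_gt0 p_prime) // logn_prime // eqxx add1n eqSS -leqn0 leqNgt logn_gt0
           mem_primes p_prime k0 pk.
Qed.

Lemma moebius_ndvd (p k : nat) : prime p -> (0 < k)%N -> ~~ (p %| k)%N ->
  moebius (p * k) = - moebius k.
Proof.
move=> p_prime k0 pk.
have Ep : perm_eq (primes (p * k)) (p :: primes k).
  apply: uniq_perm; rewrite /= ?primes_uniq ?mem_primes ?(negPf pk) ?andbF //.
  move=> r; rewrite in_cons !mem_primes muln_gt0 (prime_gt0 p_prime) // k0 /=.
  have [r_prime|nr] := boolP (prime r); rewrite /=.
    by rewrite Euclid_dvdM // dvdn_prime2.
  by case: eqP nr => // ->; rewrite p_prime.
rewrite /moebius (perm_size Ep) (perm_all _ Ep) /=.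
rewrite lognM ?(prime_gt0 p_prime) // logn_prime // eqxx lognE (negPf pk) !andbF addn0 eqxx /=.
have -> : all (fun r => logn r (p * k) == 1%N) (primes k) =
          all (fun r => logn r k == 1%N) (primes k).
  apply: eq_in_all => r; rewrite mem_primes => /and3P[r_prime _ rk].
  rewrite lognM ?(prime_gt0 p_prime) // logn_prime //.
  by have [E|//] := eqVneq r p; rewrite E (negPf pk) in rk.
by case: ifP => _; rewrite ?oppr0 // exprS mulN1r.
Qed.

(** For a prime factor [p] of [n], the divisors [p * t] with [p] dividing [t] contribute [0], and
    the other [p * t] cancel against the divisors [t] prime to [p]. *)
Lemma sum_moebius n : (0 < n)%N -> \sum_(k <- divisors n) moebius k = (n == 1%N)%:R.
Proof.
move=> n0; have [->|n1] := eqVneq n 1%N; first by rewrite big_seq1.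
pose p := pdiv n; have p_prime : prime p by rewrite pdiv_prime // ltn_neqAle eq_sym n1.
have pn : (p %| n)%N by exact: pdiv_dvd.
have np0 : (0 < n %/ p)%N by rewrite divn_gt0 ?(prime_gt0 p_prime) // dvdn_leq.
rewrite (bigID (fun k => p %| k)%N) /= addrC.
have E1 : perm_eq [seq k <- divisors n | (p %| k)%N] [seq (p * k)%N | k <- divisors (n %/ p)].
  apply: uniq_perm; first by rewrite filter_uniq ?divisors_uniq.
    rewrite map_inj_uniq ?divisors_uniq // => x y /eqP.
    by rewrite eqn_pmul2l ?(prime_gt0 p_prime) // => /eqP.
  move=> k; rewrite mem_filter -dvdn_divisors //; apply/andP/mapP.
    move=> [pk kn]; exists (k %/ p)%N; last by rewrite mulnC divnK.
    by rewrite -dvdn_divisors // dvdn_divRL // divnK.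
  move=> [t]; rewrite -dvdn_divisors // => tn ->; rewrite dvdn_mulr //.
  by rewrite -(divnK pn) mulnC dvdn_pmul2r ?(prime_gt0 p_prime).
have E2 : perm_eq [seq k <- divisors n | ~~ (p %| k)%N]
                  [seq k <- divisors (n %/ p) | ~~ (p %| k)%N].
  apply: uniq_perm; rewrite ?filter_uniq ?divisors_uniq // => k.
  rewrite !mem_filter -!dvdn_divisors //; case: (boolP (p %| k)%N) => //= pk.
  rewrite -{1}(divnK pn) Gauss_dvdl // coprime_sym prime_coprime //.
rewrite -big_filter (perm_big _ E2) big_filter -[X in _ + X]big_filter (perm_big _ E1).
rewrite big_map [X in _ + X](bigID (fun k => p %| k)%N) /=.
rewrite [X in _ + (X + _)]big_seq_cond [X in _ + (X + _)]big1 ?add0r; last first.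
  move=> k; rewrite -dvdn_divisors // => /andP[kn pk].
  by rewrite moebius_dvd // (dvdn_gt0 np0).
rewrite big_seq_cond [X in _ + X]big_seq_cond -big_split big1 //= => k.
rewrite -dvdn_divisors // => /andP[kn pk].
by rewrite moebius_ndvd ?subrr // (dvdn_gt0 np0).
Qed.

(** If [q] divides [n], then [k -> n / k] maps the multiples of [q] dividing [n] bijectively onto
    the divisors of [n / q]. *)
Lemma sum_moebius_dvd n q : (0 < n)%N -> (0 < q)%N ->
  \sum_(k <- divisors n | (q %| k)%N) moebius (n %/ k) = (q == n)%:R.
Proof.
move=> n0 q0; have [qn|qn] := boolP (q %| n)%N; last first.
  rewrite big_seq_cond big1 => [|k].
    by case: eqP qn => // ->; rewrite dvdnn.
  by rewrite -dvdn_divisors // => /andP[kn qk]; rewrite (dvdn_trans qk kn) in qn.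
have nq0 : (0 < n %/ q)%N by rewrite divn_gt0 // dvdn_leq.
have -> : (q == n) = (n %/ q == 1)%N by rewrite [RHS]eq_sym eqn_div // mul1n.
rewrite -sum_moebius // -big_filter -(big_map (fun k => n %/ k)%N predT moebius).
apply: perm_big; apply: uniq_perm; rewrite ?divisors_uniq //.
  rewrite map_inj_in_uniq ?filter_uniq ?divisors_uniq // => x y.
  rewrite !mem_filter -!dvdn_divisors // => /andP[_ xn] /andP[_ yn] E.
  apply/eqP; rewrite -(eqn_pmul2r (_ : 0 < n %/ x)%N); last first.
    by rewrite divn_gt0 ?(dvdn_gt0 n0) // dvdn_leq.
  by rewrite {2}E mulnC divnK // mulnC divnK.
move=> t; rewrite -dvdn_divisors //; apply/mapP/idP.
  move=> [k]; rewrite mem_filter -dvdn_divisors // => /andP[qk kn] ->.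
  have k0 : (0 < k)%N by rewrite (dvdn_gt0 n0).
  rewrite dvdn_divRL // -{2}(divnK kn) dvdn_pmul2l //.
  by rewrite divn_gt0 // dvdn_leq.
move=> tn; have t0 : (0 < t)%N by rewrite (dvdn_gt0 nq0).
have tn1 : (t %| n)%N by rewrite (dvdn_trans tn) ?dvdn_div.
exists (n %/ t)%N; last by rewrite divnA // mulKn.
rewrite mem_filter -dvdn_divisors // dvdn_div // andbT dvdn_divRL // mulnC.
by rewrite -dvdn_divRL.
Qed.

(** Subtracting [q] repeatedly reduces to [k <= q], where [q] is the least positive solution. *)
Lemma additive_pred_dvdn (P : pred nat) q :
  (forall k l, (0 < k)%N -> (0 < l)%N -> P k -> P (k + l)%N = P l) ->
  (0 < q)%N -> P q -> all (predC P) (iota 1 q.-1) ->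
  forall k, (0 < k)%N -> P k = (q %| k)%N.
Proof.
move=> P_add q0 Pq /allP q_min k.
have [N] := ubnP k; elim: N k => // N IH k lt_kN k_gt0.
have [lt_kq|lt_qk|->] := ltngtP k q; last by rewrite Pq dvdnn.
  rewrite gtnNdvd //; apply/negbTE/q_min.
  by rewrite mem_iota k_gt0 add1n prednK.
have kq0 : (0 < k - q)%N by rewrite subn_gt0.
rewrite -{1}(subnKC (ltnW lt_qk)) P_add // IH //; last by lia.
by rewrite dvdn_subl ?dvdnn // ltnW.
Qed.

(* The sets of positive integers met below are closed under addition and cancellation,
   hence empty or of the form [q * N]. *)
Lemma sum_moebius_pred (P : pred nat) n : (0 < n)%N ->
  (forall k l, (0 < k)%N -> (0 < l)%N -> P k -> P (k + l)%N = P l) ->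
  \sum_(k <- divisors n | P k) moebius (n %/ k) =
    (P n && all (predC P) (iota 1 n.-1))%:R.
Proof.
move=> n0 P_add.
have [[k0]|none] := pselect (exists k, (0 < k)%N && P k); last first.
  have nP k : (0 < k)%N -> P k = false.
    by move=> k0; apply/negP => Pk; apply: none; exists k; rewrite k0.
  rewrite nP // big_seq_cond big1 // => k.
  by rewrite -dvdn_divisors // => /andP[kn]; rewrite nP // (dvdn_gt0 n0).
move=> Pk0; have ex : exists k, (0 < k)%N && P k by exists k0.
case: (ex_minnP ex) => q /andP[q0 Pq] q_min.
have q_least : all (predC P) (iota 1 q.-1).
  apply/allP => k; rewrite mem_iota add1n prednK // => /andP[k_gt0 lt_kq].
  by apply/negP => Pk; have := q_min k; rewrite k_gt0 Pk leqNgt lt_kq => /(_ isT).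
have PE := additive_pred_dvdn P_add q0 Pq q_least.
have -> : P n && all (predC P) (iota 1 n.-1) = (q == n).
  apply/andP/eqP => [[Pn n_least]|<-] //.
  have := additive_pred_dvdn P_add n0 Pn n_least q0.
  rewrite Pq => /esym nq; apply/eqP; rewrite eqn_dvd nq andbT.
  by rewrite -PE.
rewrite -sum_moebius_dvd // big_seq_cond [RHS]big_seq_cond; apply: eq_bigl => k.
by rewrite -dvdn_divisors //; case: (boolP (k %| n)%N) => //= kn; rewrite PE // (dvdn_gt0 n0).
Qed.

(** * The Misiurewicz polynomials *)

(** The list [r] may be larger than the set of roots, so that several polynomials can be factored
    over one common list. *)
Lemma prod_simple_roots (q : {poly algC}) (r : seq algC) : q \is monic ->
  (forall c, root q c -> q^`().[c] != 0) -> uniq r -> {subset root q <= r} ->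
  q = \prod_(c <- r | root q c) ('X - c%:P).
Proof.
move=> mq sq ur sr; have [s Es] := closed_field_poly_normal q.
rewrite (monicP mq) scale1r in Es.
have us : uniq s.
  by rewrite -separable_prod_XsubC -Es unlock; apply/Pdiv.ClosedField.coprimepP.
rewrite {1}Es -[RHS]big_filter; apply: perm_big; apply: uniq_perm; rewrite ?filter_uniq // => c.
rewrite mem_filter; have -> : (c \in s) = root q c by rewrite Es root_prod_XsubC.
by case: (boolP (root q c)) => //= /sr ->.
Qed.

Lemma expfz_prod (F : fieldType) (I : Type) (r : seq I) (P : pred I) (f : I -> F) (z : int) :
  (\prod_(i <- r | P i) f i) ^ z = \prod_(i <- r | P i) f i ^ z.
Proof. by apply: (big_morph (fun x => x ^ z)) => [x y|]; rewrite ?expfzMl ?exp1rz. Qed.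

Lemma expfz_sum (F : fieldType) (I : Type) (r : seq I) (P : pred I) (x : F) (z : I -> int) :
  x != 0 -> x ^ (\sum_(i <- r | P i) z i) = \prod_(i <- r | P i) x ^ z i.
Proof. by move=> x0; apply: (big_morph (fun n => x ^ n)) => [m n|//]; rewrite expfzDr. Qed.

(** * Simplicity of the roots, and factorization *)

Section MisiurewiczPoly.

Variables (p e d : nat) (zeta : algC).
Hypotheses (p_prime : prime p) (e_gt0 : (0 < e)%N) (dE : d = (p ^ e)%N).
Hypotheses (zeta_unity : zeta ^+ d = 1) (zeta_neq1 : zeta != 1).
Let d_gt1 : (1 < d)%N := prime_power_gt1 p_prime e_gt0 dE.

Local Notation aX := (crit_orbit d).
Local Notation dX M k := (crit_orbit d (M + k) - zeta *: crit_orbit d M).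

Lemma crit_orbitS i : aX i.+1 = aX i ^+ d + 'X.
Proof. by []. Qed.

Lemma delta_horner M k c : (dX M k).[c] = orbit0 d c (M + k) - zeta * orbit0 d c M.
Proof. by rewrite hornerD hornerN hornerZ !orbit0_horner. Qed.

Lemma crit_orbit_monic_size i :
  (aX i.+1 \is monic) && (size (aX i.+1) == (d ^ i).+1).
Proof.
elim: i => [|i /andP[mi /eqP si]].
  by rewrite crit_orbitS expr0n; case: d d_gt1 => // d' _; rewrite add0r monicX size_polyX.
have s1 : size (aX i.+1 ^+ d) = (d ^ i.+1).+1.
  have := size_exp (aX i.+1) d; rewrite si /= -expnSr => <-.
  by rewrite prednK // size_poly_gt0 monic_neq0 ?monic_exp.
have lt : (size ('X : {poly algC}) < size (aX i.+1 ^+ d))%N.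
  by rewrite s1 size_polyX ltnS (leq_trans d_gt1) // -{1}(expn1 d) leq_exp2l.
by rewrite crit_orbitS monicE lead_coefDl // size_polyDl // s1 eqxx andbT -monicE monic_exp.
Qed.

Lemma crit_orbit_monic i : (0 < i)%N -> aX i \is monic.
Proof. by case: i => // i _; have /andP[] := crit_orbit_monic_size i. Qed.

Lemma delta_monic M k : (0 < M)%N -> (0 < k)%N -> dX M k \is monic.
Proof.
case: M => // M _; case: k => // k _.
have /andP[m1 /eqP s1] := crit_orbit_monic_size (M + k.+1).
have /andP[m2 /eqP s2] := crit_orbit_monic_size M.
rewrite monicE lead_coefDl -?monicE // size_polyN s1 ltnS.
by rewrite (leq_trans (size_scale_leq _ _)) // s2 ltn_exp2l // -addn1 leq_add2l.
Qed.

Lemma crit_orbit_over (V : valuation_ring algC) i : aX i \is a polyOver V.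
Proof.
elim: i => [|i IH]; first exact: rpred0.
by rewrite crit_orbitS rpredD ?rpredX ?polyOverX.
Qed.

Lemma delta_over (V : valuation_ring algC) M k : dX M k \is a polyOver V.
Proof.
rewrite rpredB ?polyOverZ ?crit_orbit_over //.
exact: (root_of_unity_valuation V p_prime e_gt0 dE zeta_unity).
Qed.

Local Notation bX i c := ((crit_orbit d i)^`().[c]).

Lemma crit_orbit_derivS i c :
  bX i.+1 c = orbit0 d c i ^+ d.-1 * bX i c * d%:R + 1.
Proof.
rewrite crit_orbitS derivD derivX deriv_exp hornerD hornerMn hornerM horner_exp.
by rewrite orbit0_horner hornerC mulr_natr [X in X *+ _]mulrC.
Qed.

Section Local.

Variables (V : valuation_ring algC) (c : algC).
Local Notation mV := (valuation_ideal V).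
Hypotheses (mp : p%:R \in mV) (Vc : c \in V).
Let Va i : orbit0 d c i \in V := orbit0_valuation d Vc i.
Let Vz : zeta \in V := root_of_unity_valuation V p_prime e_gt0 dE zeta_unity.
Let mz : 1 - zeta \in mV := one_sub_ideal p_prime e_gt0 dE zeta_unity mp.

Lemma crit_orbit_deriv_valuation i : bX i c \in V.
Proof.
elim: i => [|i IH]; first by rewrite deriv0 horner0 rpred0.
by rewrite crit_orbit_derivS rpredD ?rpred1 // !rpredM ?rpredX ?rpred_nat.
Qed.

Let md : d%:R \in mV.
Proof. by rewrite dE natrX valuation_idealX. Qed.

Lemma crit_orbit_deriv_ideal i : bX i.+1 c - 1 \in mV.
Proof.
rewrite crit_orbit_derivS addrK valuation_idealMl // rpredM ?rpredX //.
exact: crit_orbit_deriv_valuation.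
Qed.

Lemma crit_orbit_deriv_neq0 i : (0 < i)%N -> bX i c != 0.
Proof.
case: i => // i _; apply/eqP => E; have := crit_orbit_deriv_ideal i.
by rewrite E sub0r rpredN (negPf (valuation_ideal1 V)).
Qed.

(** The derivative is [(1 - zeta) + d * B], and [1 - zeta] divides [p], hence [d]. The quotient is
    [1 + w * p^(e-1) * B]; since [e] may be [1], it is [B] that must be in the maximal ideal. *)
Lemma delta_deriv_neq0 M k : (0 < M)%N -> (0 < k)%N -> root (dX M k) c ->
  (dX M k)^`().[c] != 0.
Proof.
case: M => // M _ k_gt0; rewrite rootE delta_horner subr_eq0 => /eqP E.
(* The root condition concerns the index [M + 1]; the congruence is carried down to [k] and back up
   to the index [M]. *)
have mx : orbit0 d c (M + k) - orbit0 d c M \in mV.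
  rewrite (orbit0_diff_ideal p_prime e_gt0 dE Vc) //.
  rewrite -(orbit0_diff_ideal p_prime e_gt0 dE Vc M.+1) // E.
  have -> : zeta * orbit0 d c M.+1 - orbit0 d c M.+1 =
    - ((1 - zeta) * orbit0 d c M.+1) by ring.
  by rewrite rpredN valuation_idealMr.
rewrite derivB derivZ hornerD hornerN hornerZ addSn !crit_orbit_derivS.
set x := orbit0 d c (M + k) in mx *; set y := orbit0 d c M in mx *.
set b := bX (M + k) c; set b' := bX M c.
have [w Vw Ew] := prime_dvd_one_sub V p_prime e_gt0 dE zeta_unity zeta_neq1.
have Ed : d%:R = (1 - zeta) * w * p%:R ^+ e.-1 :> algC.
  by rewrite -Ew -exprS prednK // dE natrX.
have mb : b - 1 \in mV.
  rewrite /b; case: k k_gt0 {E mx x b} => // k _.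
  by rewrite addnS; apply: crit_orbit_deriv_ideal.
(* At index [0] the derivative [b'] is [0] and not congruent to [1]; there [y = a_0 = 0] and
   [d - 1 > 0] give the claim. *)
have mb' : y ^+ d.-1 * (b' - 1) \in mV.
  rewrite /b' /y; case: (M) => [|M']; last first.
    by rewrite valuation_idealMl ?rpredX ?crit_orbit_deriv_ideal.
  rewrite [orbit0 d c 0]/(0 : algC) expr0n.
  by case: d d_gt1 => [|[|d']] // _; rewrite mul0r rpred0.
pose B := x ^+ d.-1 * b - zeta * (y ^+ d.-1 * b').
have [Vx Vy] : x \in V /\ y \in V by split; apply: Va.
have mB : B \in mV.
  have [s Vs Es] := sub_exp_valuation d.-1 Vx Vy.
  have -> : B = x ^+ d.-1 * (b - 1) + (x ^+ d.-1 - y ^+ d.-1) + (1 - zeta) * y ^+ d.-1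
      - zeta * (y ^+ d.-1 * (b' - 1)) by rewrite /B; ring.
  rewrite Es; apply: rpredB; last exact: valuation_idealMl.
  apply: rpredD; last by rewrite valuation_idealMr ?rpredX.
  by apply: rpredD; rewrite ?(valuation_idealMr mx) // valuation_idealMl ?rpredX.
have -> : x ^+ d.-1 * b * d%:R + 1 - zeta * (y ^+ d.-1 * b' * d%:R + 1) =
    (1 - zeta) * (1 + w * p%:R ^+ e.-1 * B) by rewrite /B Ed; ring.
apply: mulf_neq0; first by rewrite subr_eq0 eq_sym.
apply: (@valuation_unit_neq0 _ V); rewrite valuation_unitD ?rpred1 //.
by rewrite valuation_idealMl // rpredM // rpredX ?rpred_nat.
Qed.

End Local.

(** Every root is integral, so it lies in a valuation ring above [p], where the derivative was shown
    not to vanish. *)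
Lemma crit_orbit_prod k r : (0 < k)%N -> uniq r -> {subset root (aX k) <= r} ->
  aX k = \prod_(c <- r | root (aX k) c) ('X - c%:P).
Proof.
move=> k0; apply: prod_simple_roots; first exact: crit_orbit_monic.
move=> c rc; have [V mp] := exists_valuation_ring_prime p_prime.
apply: (crit_orbit_deriv_neq0 mp) => //.
exact: monic_root_valuation (crit_orbit_monic k0) (crit_orbit_over V k) rc.
Qed.

Lemma delta_prod M k r : (0 < M)%N -> (0 < k)%N -> uniq r -> {subset root (dX M k) <= r} ->
  dX M k = \prod_(c <- r | root (dX M k) c) ('X - c%:P).
Proof.
move=> M0 k0; apply: prod_simple_roots; first exact: delta_monic.
move=> c rc; have [V mp] := exists_valuation_ring_prime p_prime.
apply: (delta_deriv_neq0 mp) => //.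
exact: monic_root_valuation (delta_monic M0 k0) (delta_over V M k) rc.
Qed.

Section Factorization.

Variables (M n : nat).
Hypotheses (M_gt0 : (0 < M)%N) (n_gt0 : (0 < n)%N).

Let A c k := root (dX M k) c.
Let B c k := root (aX k) c.
Let least (P : pred nat) := P n && all (predC P) (iota 1 n.-1).

Let AE c k : A c k = (orbit0 d c (M + k) == zeta * orbit0 d c M).
Proof. by rewrite /A rootE delta_horner subr_eq0. Qed.

Let BE c k : B c k = (orbit0 d c k == 0).
Proof. by rewrite /B rootE orbit0_horner. Qed.

Let A_add c k l : (0 < k)%N -> (0 < l)%N -> A c k -> A c (k + l) = A c l.
Proof.
move=> k0 l0; rewrite !AE => /eqP E.
have Ek : orbit0 d c (M.+1 + k) = orbit0 d c M.+1.
  by rewrite addSn !orbit0S E exprMn zeta_unity mul1r.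
by rewrite addnCA addnC (orbit0_periodic Ek) // -addn1 leq_add2l.
Qed.

Let B_add c k l : (0 < k)%N -> (0 < l)%N -> B c k -> B c (k + l) = B c l.
Proof.
move=> k0 l0; rewrite !BE => /eqP E.
have Ek : orbit0 d c (0 + k) = orbit0 d c 0 by [].
by rewrite addnC (orbit0_periodic Ek).
Qed.

Let eqAB c : orbit0 d c M = 0 -> A c =1 B c.
Proof.
move=> E k; rewrite AE BE E mulr0.
have Ek : orbit0 d c (0 + M) = orbit0 d c 0 by [].
by rewrite addnC (orbit0_periodic Ek).
Qed.

Let least_eq (P Q : pred nat) : P =1 Q -> least P = least Q.
Proof. by move=> E; rewrite /least E; congr (_ && _); apply: eq_all => k /=; rewrite E. Qed.

(** If [0] has exact period [n] and [n] divides [M], then [a_M = 0] and the two conditions coincide.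
    This keeps the exponent in [good_exponent] from being [-1]. *)
Let least_dvd c : (n %| M)%N -> least (B c) -> least (A c).
Proof.
move=> /dvdnP[s Es] lB; rewrite (least_eq (eqAB _)) //.
have : B c n by case/andP: lB.
rewrite BE => /eqP E; have Ek : orbit0 d c (0 + n) = orbit0 d c 0 by [].
by rewrite Es -[(s * n)%N]add0n (orbit0_periodicM s Ek).
Qed.

Let good c := least (A c) && ~~ ((n %| M)%N && least (B c)).

Let good_point c : good c -> misiurewicz_point d M n zeta c.
Proof.
case/andP=> /andP[An nA] nB.
split; first by apply/eqP; rewrite -AE.
  (* If [a_M = 0], then [A] and [B] coincide, so [0] has exact period [n] and [n] divides [M]: this
     is what [good] excludes. *)
  apply: contra nB => /eqP E.
  have EAB := eqAB E.
  have lB : least (B c) by rewrite -(least_eq EAB) /least An.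
  have /andP[Bn nB] := lB.
  by rewrite lB andbT -(additive_pred_dvdn (@B_add c) n_gt0 Bn nB) // BE E.
case=> [|k] Ek; first exact: dvdn0.
rewrite -(additive_pred_dvdn (@A_add c) n_gt0 An nA) // -(A_add n_gt0 _ An) //.
by rewrite AE addnA (orbit0_periodic Ek) -?AE // -addn1 leq_add2l.
Qed.

Let good_exponent c :
  ((least (A c))%:R - (if (n %| M)%N then (least (B c))%:R else 0) : int) = (good c)%:R.
Proof.
rewrite /good; have := @least_dvd c; case: (n %| M)%N; last by rewrite subr0 andbT.
by case: (least (B c)) => [/(_ isT isT) ->|_]; rewrite ?subr0 ?andbT.
Qed.

Let points_seq : exists2 r : seq algC, uniq r &
  forall c, (c \in r) = has (fun k => A c k || B c k) (divisors n).
Proof.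
pose Q := \prod_(k <- divisors n) (dX M k * aX k).
have [r Er] := closed_field_poly_normal Q.
have mQ : Q \is monic.
  rewrite /Q big_seq; apply: monic_prod => k; rewrite -dvdn_divisors // => kn.
  have k0 := dvdn_gt0 n_gt0 kn.
  by rewrite rpredM ?delta_monic ?crit_orbit_monic.
exists (undup r) => [|c]; first exact: undup_uniq.
rewrite mem_undup; have -> : (c \in r) = root Q c.
  by rewrite Er (monicP mQ) scale1r root_prod_XsubC.
rewrite /Q; elim: (divisors n) => [|k s IH]; first by rewrite big_nil rootC oner_eq0.
by rewrite big_cons !rootM IH.
Qed.

(** The morphism [h] is left free for two uses: the embedding in the fraction field, which
    identifies the polynomial, and the evaluation at a parameter, which gives its value. *)
Lemma misiurewicz_factorization : exists2 G : {poly algC},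
  forall c, root G c -> misiurewicz_point d M n zeta c &
  forall (E : fieldType) (h : {rmorphism {poly algC} -> E}),
    (forall k, (0 < k)%N -> h (dX M k) != 0) -> (forall k, (0 < k)%N -> h (aX k) != 0) ->
    h G = \prod_(k <- divisors n) h (dX M k) ^ moebius (n %/ k) *
      (if (n %| M)%N then \prod_(k <- divisors n) h (aX k) ^ (- moebius (n %/ k)) else 1).
Proof.
have [r ur rE] := points_seq.
exists (\prod_(c <- r | good c) ('X - c%:P)).
  move=> c; rewrite -big_filter root_prod_XsubC mem_filter => /andP[gc _].
  exact: good_point.
move=> E h hA hB; pose t c := h ('X - c%:P).
have hAE k : (k %| n)%N -> h (dX M k) = \prod_(c <- r | A c k) t c.
  move=> kn; rewrite -rmorph_prod; congr (h _); apply: delta_prod => //.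
    by rewrite (dvdn_gt0 n_gt0).
  by move=> c rc; rewrite rE; apply/hasP; exists k; rewrite -?dvdn_divisors //; apply/orP; left.
have hBE k : (k %| n)%N -> h (aX k) = \prod_(c <- r | B c k) t c.
  move=> kn; rewrite -rmorph_prod; congr (h _); apply: crit_orbit_prod => //.
    by rewrite (dvdn_gt0 n_gt0).
  by move=> c rc; rewrite rE; apply/hasP; exists k; rewrite -?dvdn_divisors //; apply/orP; right.
have t0 c : c \in r -> t c != 0.
  move=> rc; have := rc; rewrite rE => /hasP[k]; rewrite -dvdn_divisors // => kn.
  have k0 : (0 < k)%N by rewrite (dvdn_gt0 n_gt0).
  move=> /orP[Ac|Bc].
    apply: contraNneq (hA _ k0) => tc; rewrite hAE // (big_rem c) //= Ac tc.
    by rewrite mul0r.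
  apply: contraNneq (hB _ k0) => tc; rewrite hBE // (big_rem c) //= Bc tc.
  by rewrite mul0r.
(* Exchanging the products collects, for each linear factor, the sum of Moebius values computed by
   [sum_moebius_pred]. *)
have swap (P : algC -> pred nat) (z : nat -> int) :
    \prod_(k <- divisors n) (\prod_(c <- r | P c k) t c) ^ z k =
    \prod_(c <- r) t c ^ (\sum_(k <- divisors n | P c k) z k).
  under eq_bigr => k _ do rewrite expfz_prod big_mkcond.
  rewrite exchange_big big_seq [RHS]big_seq; apply: eq_bigr => c rc.
  by rewrite -big_mkcond expfz_sum // t0.
have -> : \prod_(k <- divisors n) h (dX M k) ^ moebius (n %/ k) =
    \prod_(c <- r) t c ^ (least (A c))%:R.
  rewrite -(eq_bigr _ (fun c _ => congr1 (fun z => t c ^ z)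
      (sum_moebius_pred n_gt0 (@A_add c)))) -swap.
  rewrite big_seq [RHS]big_seq; apply: eq_bigr => k.
  by rewrite -dvdn_divisors // => kn; rewrite hAE.
have -> : (if (n %| M)%N then \prod_(k <- divisors n) h (aX k) ^ (- moebius (n %/ k)) else 1) =
    \prod_(c <- r) t c ^ (- (if (n %| M)%N then (least (B c))%:R else 0)).
  case: ifP => _; last by rewrite big1 // => c _; rewrite oppr0.
  under [RHS]eq_bigr => c _ do
    rewrite -(sum_moebius_pred n_gt0 (@B_add c)) -sumrN.
  rewrite -swap big_seq [RHS]big_seq; apply: eq_bigr => k.
  by rewrite -dvdn_divisors // => kn; rewrite hBE.
rewrite -big_split /= rmorph_prod big_mkcond big_seq [RHS]big_seq; apply: eq_bigr => c rc.
by rewrite -expfzDr ?t0 // good_exponent; case: (good c).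
Qed.

(** The fraction is the image of a polynomial, so [poly_of_frac] returns that polynomial and not a
    junk value. *)
Lemma misiurewiczE : exists2 G : {poly algC}, misiurewicz d M.+1 n zeta = G &
  (forall c, root G c -> misiurewicz_point d M n zeta c) /\
  forall c, (forall k, (0 < k)%N -> (dX M k).[c] != 0) ->
    (forall k, (0 < k)%N -> (aX k).[c] != 0) ->
    G.[c] = \prod_(k <- divisors n) (dX M k).[c] ^ moebius (n %/ k) *
      (if (n %| M)%N then \prod_(k <- divisors n) (aX k).[c] ^ (- moebius (n %/ k)) else 1).
Proof.
have [G rG hG] := misiurewicz_factorization; exists G; last split=> //.
  rewrite -[RHS]poly_of_fracK /misiurewicz; congr (poly_of_frac _).
  rewrite (hG _ (@FracField.tofrac {poly algC})) /misiurewicz_frac.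
  - rewrite subn1 /=.
    under eq_bigr => k _ do rewrite addSn subn1 /=.
    by case: ifP; rewrite ?mulr1.
  - by move=> k k0; rewrite tofrac_eq0 monic_neq0 ?delta_monic.
  - by move=> k k0; rewrite tofrac_eq0 monic_neq0 ?crit_orbit_monic.
by move=> c hA hB; have := hG _ (horner_eval c) hA hB.
Qed.

End Factorization.
End MisiurewiczPoly.

(** * Ideals of the ring of integers *)

Section Ideals.

Variable c : algC.
Local Notation K := (Qadjoin c).
Local Notation OK := (ring_of_integers K).
Local Notation ev u := ((map_poly (ratr : rat -> algC) u).[c]).

Lemma Qadjoin_poly u : K (ev u).
Proof.
by exists u, 1; rewrite rmorph1 hornerC oner_eq0 divr1.
Qed.

Lemma QadjoinM x y : K x -> K y -> K (x * y).
Proof.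
move=> [u [v [v0 ->]]] [u' [v' [v'0 ->]]]; exists (u * u'), (v * v').
by rewrite !rmorphM !hornerM mulf_neq0 // mulf_div.
Qed.

Lemma QadjoinB x y : K x -> K y -> K (x - y).
Proof.
move=> [u [v [v0 ->]]] [u' [v' [v'0 ->]]]; exists (u * v' - u' * v), (v * v').
rewrite rmorphB !rmorphM !hornerD hornerN !hornerM mulf_neq0 //; split=> //.
by field; rewrite v0 v'0.
Qed.

Lemma QadjoinV x : K x -> K x^-1.
Proof.
move=> [u [v [v0 ->]]]; have [u0|u0] := eqVneq (ev u) 0.
  rewrite u0 mul0r invr0; have := Qadjoin_poly 0.
  by rewrite rmorph0 horner0.
by exists v, u; rewrite invf_div.
Qed.

Lemma Qadjoin1 : K 1.
Proof. by have := Qadjoin_poly 1; rewrite rmorph1 hornerC. Qed.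

Lemma QadjoinX x n : K x -> K (x ^+ n).
Proof.
by move=> Kx; elim: n => [|n IH]; rewrite ?exprS; [exact: Qadjoin1 | exact: QadjoinM].
Qed.

Lemma QadjoinXz x (z : int) : K x -> K (x ^ z).
Proof.
by move=> Kx; case: z => n; rewrite ?NegzE -?exprnP -?exprnN; do ?apply: QadjoinV;
   apply: QadjoinX.
Qed.

Lemma Qadjoin_prod (I : Type) (r : seq I) (f : I -> algC) :
  (forall i, K (f i)) -> K (\prod_(i <- r) f i).
Proof.
move=> Kf; elim: r => [|i r IH]; first by rewrite big_nil; apply: Qadjoin1.
by rewrite big_cons; apply: QadjoinM.
Qed.

Lemma Qadjoin_orbit d i : K (orbit0 d c i).
Proof.
pose P := iter i (unicritical d 'X) (0 : {poly rat}).
suff <- : ev P = orbit0 d c i by apply: Qadjoin_poly.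
rewrite /P; elim: i {P} => [|i IH]; first by rewrite rmorph0 horner0.
by rewrite iterS orbit0S -IH /unicritical rmorphD rmorphXn /= map_polyX !hornerE.
Qed.

Lemma OK0 : OK 0.
Proof.
split; last exact: rpred0.
by have := Qadjoin_poly 0; rewrite rmorph0 horner0.
Qed.

Lemma OK1 : OK 1.
Proof. by split; [exact: Qadjoin1 | exact: rpred1]. Qed.

Lemma OKM x y : OK x -> OK y -> OK (x * y).
Proof. by move=> [Kx Ax] [Ky Ay]; split; [exact: QadjoinM | exact: rpredM]. Qed.

Lemma OKD x y : OK x -> OK y -> OK (x + y).
Proof.
move=> [Kx Ax] [Ky Ay]; split; last exact: rpredD.
rewrite -[y]opprK; apply: QadjoinB => //; rewrite -sub0r.
by apply: QadjoinB => //; case: OK0.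
Qed.

Lemma principal_ideal1 : principal_ideal OK 1 = OK.
Proof.
apply/seteqP; split=> [x [y Oy <-]|x Ox]; first by rewrite mul1r.
by exists x; rewrite ?mul1r.
Qed.

Lemma principal_ideal_mul a b :
  ideal_mul (principal_ideal OK a) (principal_ideal OK b) = principal_ideal OK (a * b).
Proof.
apply/seteqP; split=> [x [s [Hs ->]]|_ [x Ox <-]]; last first.
  exists [:: (a * x, b)]; split; last by rewrite big_seq1 /=; ring.
  move=> y; rewrite mem_seq1 => /eqP -> /=; split; first by exists x.
  by exists 1; rewrite ?mulr1 //; apply: OK1.
elim: s Hs => [|y s IH] Hs.
  by rewrite big_nil; exists 0; rewrite ?mulr0 //; apply: OK0.
rewrite big_cons; have [[u Ou <-] [v Ov <-]] := Hs y (mem_head _ _).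
have [z Oz <-] : principal_ideal OK (a * b) (\sum_(y <- s) y.1 * y.2).
  by apply: IH => t ts; apply: Hs; rewrite in_cons ts orbT.
by exists (u * v + z); [apply: OKD => //; apply: OKM | ring].
Qed.

Lemma principal_ideal_exp b N :
  ideal_exp OK (principal_ideal OK b) N = principal_ideal OK (b ^+ N).
Proof.
elim: N => [|N IH]; first by rewrite expr0 principal_ideal1.
by rewrite /ideal_exp iterS -/(ideal_exp _ _ _) IH principal_ideal_mul exprS.
Qed.

(** The quotient [x / y] lies in every valuation ring, so it is an algebraic integer of [K]; the
    hypothesis is symmetric, hence so is its inverse. *)
Lemma principal_ideal_eq x y : K x -> K y ->
  (forall V : valuation_ring algC, exists2 u, u \in valuation_unit V & x = u * y) ->
  principal_ideal OK x = principal_ideal OK y.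
Proof.
wlog suff sub : x y / K x -> K y ->
    (forall V : valuation_ring algC, exists2 u, u \in valuation_unit V & x = u * y) ->
    (principal_ideal OK x `<=` principal_ideal OK y)%classic.
  move=> Kx Ky xy; apply/seteqP; split; apply: sub => // V.
  have [u uu E] := xy V; exists u^-1; first by rewrite rpredV.
  by rewrite E mulKf // (valuation_unit_neq0 uu).
move=> Kx Ky xy _ [z Oz <-].
have [y0|y0] := eqVneq y 0.
  have x0 : x = 0.
    have [V _] := exists_valuation_ring_prime (isT : prime 2).
    by have [u _ ->] := xy V; rewrite y0 mulr0.
  by rewrite x0 y0; exists z.
exists (x / y * z); last by rewrite -{2}[x](divfK y0); ring.
apply: OKM => //; split; first by apply: QadjoinM => //; apply: QadjoinV.
apply: Aint_valuation => V; have [u uu ->] := xy V.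
by rewrite mulfK // valuation_unit_sub.
Qed.

End Ideals.

(** Up to units, only powers of [x] remain, and their total exponent is given by
    [sum_moebius_dvd]. *)
Lemma prod_moebius_val (F : fieldType) (V : valuation_ring F) (f : nat -> F) (x : F) n l :
  (0 < n)%N -> (0 < l)%N -> x != 0 ->
  (forall k, (0 < k)%N -> exists2 u, u \in valuation_unit V &
    f k = u * (if (n %| k)%N then x else 1)) ->
  exists2 u, u \in valuation_unit V &
    \prod_(k <- divisors l) f k ^ moebius (l %/ k) = u * (if n == l then x else 1).
Proof.
move=> n0 l0 x0 fE; pose g k := if (n %| k)%N then x else 1.
have g0 k : g k != 0 by rewrite /g; case: ifP; rewrite ?oner_eq0.
exists (\prod_(k <- divisors l) (f k / g k) ^ moebius (l %/ k)).
  rewrite big_seq; apply: rpred_prod => k; rewrite -dvdn_divisors // => kl.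
  have [u uu Eu] := fE k (dvdn_gt0 l0 kl).
  by apply: rpredXz; rewrite Eu -/(g k) mulfK.
have -> : (if n == l then x else 1) = \prod_(k <- divisors l) g k ^ moebius (l %/ k).
  have -> : (if n == l then x else 1) = x ^ ((n == l)%:R : int) by case: eqP.
  rewrite -sum_moebius_dvd // expfz_sum // big_mkcond; apply: eq_bigr => k _.
  by rewrite /g; case: ifP => // _; rewrite exp1rz.
by rewrite -big_split /=; apply: eq_bigr => k _; rewrite -expfzMl divfK.
Qed.

Theorem theorem1p8 (p e d m n : nat) (zeta c0 : algC) (l j : nat)
  (p_prime : prime p) (e_ge1 : (1 <= e)%N) (dE : d = (p ^ e)%N)
  (m_ge2 : (2 <= m)%N) (n_ge1 : (1 <= n)%N)
  (zeta_unity : zeta ^+ d = 1) (zeta_neq1 : zeta <> 1)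
  (c0_root : root (misiurewicz d m n zeta) c0)
  (l_ge1 : (1 <= l)%N) (j_ge2 : (2 <= j)%N) :
  let K := Qadjoin c0 in
  let OK := ring_of_integers K in
  let Gjl := (misiurewicz d j l zeta).[c0] in
  [/\ l <> n -> j <> m -> principal_ideal OK Gjl = OK,
      l = n -> (j < m)%N ->
        principal_ideal OK Gjl =
        ideal_exp OK (principal_ideal OK (crit_orbit d n).[c0])
          (misiurewicz_exponent d j n) &
      l = n -> (m < j)%N ->
        principal_ideal OK Gjl = principal_ideal OK (1 - zeta)].
Proof.
case: m m_ge2 c0_root => [//|M] M_gt0 c0_root; rewrite ltnS in M_gt0.
case: j j_ge2 => [//|J] J_gt0; rewrite ltnS in J_gt0.
have z1 : zeta != 1 by apply/eqP.
have [G GE [rG _]] := misiurewiczE p_prime e_ge1 dE zeta_unity z1 M_gt0 n_ge1.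
rewrite GE in c0_root; have cM := rG _ c0_root.
have [H HE [_ evH]] := misiurewiczE p_prime e_ge1 dE zeta_unity z1 J_gt0 l_ge1.
move=> K OK Gjl; rewrite /Gjl HE.
have a_neq0 k : (0 < k)%N -> orbit0 d c0 k != 0.
  exact: misiurewicz_point_neq0 zeta_unity z1 n_ge1 cM k.
have Kzeta : K zeta.
  case: cM => E aM0 _; have -> : zeta = orbit0 d c0 (M + n) / orbit0 d c0 M.
    by rewrite E mulfK.
  by apply: QadjoinM; [|apply: QadjoinV]; apply: Qadjoin_orbit.
have Kdelta i k : K (orbit0 d c0 (i + k) - zeta * orbit0 d c0 i).
  by apply: QadjoinB; [|apply: QadjoinM => //]; apply: Qadjoin_orbit.
have K1zeta : K (1 - zeta) by apply: QadjoinB => //; apply: Qadjoin1.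
have Vc (V : valuation_ring algC) : c0 \in V.
  case: cM => E aM0 _.
  apply: (monic_root_valuation (delta_monic zeta p_prime e_ge1 dE M_gt0 n_ge1)).
    exact: delta_over p_prime e_ge1 dE zeta_unity _ _ _.
  by rewrite rootE delta_horner E subrr.
pose a := orbit0 d c0.
pose X := if (J < M)%N then a n ^+ (d ^ J) else (1 - zeta) * a J.
have X0 : X != 0.
  by rewrite /X; case: ifP => _; rewrite ?expf_neq0 ?mulf_neq0 ?a_neq0 // subr_eq0 eq_sym.
(* No factor vanishes at [c0], so the product formula applies. Up to units, the first product is [X]
   or [1]; the second, present if [l] divides [J], is the inverse of [a n] or of [1]. *)
have main : J != M -> K H.[c0] /\ forall V : valuation_ring algC,
    exists2 u, u \in valuation_unit V & H.[c0] = u * ((if n == l then X else 1) /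
      (if (l %| J)%N then if n == l then a n else 1 else 1)).
  move=> neJM; rewrite evH; first last.
  - by move=> k k0; rewrite orbit0_horner a_neq0.
  - move=> k k0; rewrite delta_horner.
    by apply: (misiurewicz_delta_neq0 zeta_unity z1 n_ge1 cM).
  split.
    apply: QadjoinM.
      by apply: Qadjoin_prod => k; rewrite delta_horner; apply/QadjoinXz/Kdelta.
    case: ifP => _; last exact: Qadjoin1.
    by apply: Qadjoin_prod => k; rewrite orbit0_horner; apply/QadjoinXz/Qadjoin_orbit.
  move=> V.
  have [u uu Eu] := prod_moebius_val n_ge1 l_ge1 X0 (fun k k0 =>
    misiurewicz_delta_val p_prime e_ge1 dE zeta_unity z1 M_gt0 n_ge1 cM (Vc V) neJM J_gt0 k0).
  have [v uv Ev] := prod_moebius_val n_ge1 l_ge1 (a_neq0 _ n_ge1) (fun k k0 =>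
    misiurewicz_orbit_val p_prime e_ge1 dE zeta_unity z1 M_gt0 n_ge1 cM (Vc V) k0).
  under eq_bigr => k _ do rewrite delta_horner.
  rewrite Eu; case: (l %| J)%N; last by exists u; rewrite // invr1 !mulr1.
  exists (u / v); first by rewrite rpred_div.
  under eq_bigr => k _ do rewrite orbit0_horner -invr_expz.
  by rewrite prodfV Ev invfM mulrACA.
split.
- move=> /eqP nel /eqP neJ; rewrite eqSS in neJ; have [KH HV] := main neJ.
  rewrite -[RHS](principal_ideal1 c0); apply: principal_ideal_eq => //; first exact: Qadjoin1.
  move=> V; have [u uu ->] := HV V; exists u => //.
  by rewrite eq_sym (negPf nel); case: ifP; rewrite divr1.
- move=> Eln ltJM; rewrite ltnS in ltJM; have neJ : J != M by rewrite ltn_eqF.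
  have [KH HV] := main neJ.
  rewrite principal_ideal_exp; apply: principal_ideal_eq => //.
    by rewrite orbit0_horner; apply/QadjoinX/Qadjoin_orbit.
  move=> V; have [u uu ->] := HV V; exists u => //.
  rewrite Eln eqxx /X ltJM orbit0_horner /misiurewicz_exponent subn1 /= -/(a n).
  case: ifP => _; rewrite ?divr1 //.
  (* When [n] divides [J], the denominator removes one factor [a n], whence the exponent
     [d ^ J - 1]. *)
  have dJ0 : (0 < d ^ J)%N by rewrite expn_gt0 dE expn_gt0 prime_gt0.
  by rewrite -{1}(prednK dJ0) exprSr mulfK ?a_neq0 // subn1.
- move=> Eln ltMJ; rewrite ltnS in ltMJ; have neJ : J != M by rewrite gtn_eqF.
  have [KH HV] := main neJ.
  apply: principal_ideal_eq => // V; have [u uu ->] := HV V.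
  (* Here [X = (1 - zeta) * a_J]. If [n] divides [J], then [a_J] is associated to [a_n] and cancels
     the denominator; otherwise [a_J] is a unit. *)
  have [v uv Ev] := misiurewicz_orbit_val p_prime e_ge1 dE zeta_unity z1 M_gt0 n_ge1 cM
    (Vc V) J_gt0.
  exists (u * v); first exact: rpredM.
  rewrite Eln eqxx /X ltnNge (ltnW ltMJ) /= /a Ev.
  by case: ifP => _; field; rewrite ?a_neq0 ?oner_eq0.
Qed.
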